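(* Let $\&$ be a continuous t-norm satisfying the (S) condition and let $M>0$. Then $(\mathbb{E}^1_{[-M,M]},P)$ is a $[0,1]$-enriched domain; that is, it is Yoneda complete and continuous, and for all $u,v\in\mathbb{E}^1_{[-M,M]}$, $$\mathfrak{w}(v,u)=\inf_{\Phi\in\mathcal{I}\mathbb{E}^1_{[-M,M]}}\big(P(u,\operatorname{colim}\Phi)\to\Phi(v)\big)=\Phi_u(v).$$
   Context: T-norms: a t-norm is a commutative, associative binary operation $\&$ on $[0,1]$, monotone in each variable, with $x\,\&\,1=x$. Its residual implication is $x\to y=\sup\{t\in[0,1]\mid x\,\&\,t\le y\}$. A continuous t-norm satisfies the (S) condition if it satisfies one (equivalently, by a known result, all) of: (i) for each non-idempotent $p\in[0,1]$, with $p^-$ the greatest idempotent in $[0,p]$ and $p^+$ the least idempotent in $[p,1]$, the restriction of $\&$ to $[p^-,p^+]$ is isomorphic to the product t-norm on $[0,1]$ whenever $p^->0$; (ii) $\to:[0,1]^2\to[0,1]$ is continuous at every point off the diagonal; (iii) for each $p\in(0,1]$, the function $p\to-$ is continuous on $[0,p)$. Fuzzy numbers: $\mathbb{E}^1$ is the set of functions $u:\mathbb{R}\to[0,1]$ such that (1) $u(x_0)=1$ for some $x_0$; (2) $u(\lambda x+(1-\lambda)y)\ge\min\{u(x),u(y)\}$ for all $x,y\in\mathbb{R},\lambda\in[0,1]$; (3) $u$ is upper-semicontinuous; (4) $[u]_0=\overline{\{x: u(x)>0\}}$ is compact. Put $[u]_\alpha=\{x: u(x)\ge\alpha\}$ for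 $\alpha\in(0,1]$ and write $[u]_\alpha=[u_\alpha^-,u_\alpha^+]$. The left and right parts of $u$ are $u^\ell,u^r:\mathbb{R}\to[0,1]$: $u^\ell(x)=0$ for $x<u_0^-$, $u^\ell(x)=u(x)$ for $x\in[u_0^-,u_1^-]$, $u^\ell(x)=1$ for $x>u_1^-$; $u^r(x)=1$ for $x<u_1^-$, $u^r(x)=u(x)$ for $x\in[u_1^-,u_0^+]$, $u^r(x)=0$ for $x>u_0^+$. A fuzzy number is determined by its pair $(u^\ell,u^r)$. Define $P(u,v)=\inf_{x\in\mathbb{R}}\big((v^\ell(x)\to u^\ell(x))\wedge(u^r(x)\to v^r(x))\big)$. For $M>0$, $\mathbb{E}^1_{[-M,M]}$ is the set of $u\in\mathbb{E}^1$ with support $[u]_0\subseteq[-M,M]$. Its underlying order is $u\sqsubseteq v\iff P(u,v)=1$, and $(\mathbb{E}^1_{[-M,M]})_0=(\mathbb{E}^1_{[-M,M]},\sqsubseteq)$ is a complete lattice. Enriched categories: a $[0,1]$-enriched category is a set $X$ with a map $X(-,-):X\times X\to[0,1]$ such that $X(x,x)=1$ and $X(y,z)\,\&\,X(x,y)\le X(x,z)$. Here $X=\mathbb{E}^1_{[-M,M]}$ and $X(u,v)=P(u,v)$. A functor $f:X\to Y$ is a map with $X(x,y)\le Y(f(x),f(y))$; a functor $f:X\to Y$ is left adjoint to a functor $g:Y\to X$ if $Y(f(x),y)=X(x,g(y))$ for all $x,y$. A weight is a map $\phi:X\to[0,1]$ with $X(y,x)\le\phi(x)\to\phi(y)$;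 a colimit of $\phi$ is an element $\operatorname{colim}\phi$ with $X(\operatorname{colim}\phi,x)=\inf_{y\in X}(\phi(y)\to X(y,x))$ for all $x$. A coweight is a map $\psi:X\to[0,1]$ with $X(x,y)\le\psi(x)\to\psi(y)$; a limit of $\psi$ is an element $\lim\psi$ with $X(x,\lim\psi)=\inf_{y\in X}(\psi(y)\to X(x,y))$ for all $x$. A net $\{x_i\}_{i\in D}$ is forward Cauchy if $\sup_{i\in D}\inf_{k\ge j\ge i}X(x_j,x_k)=1$. A forward Cauchy ideal is a weight of the form $\sup_{i\in D}\inf_{j\ge i}X(-,x_j)$ for some forward Cauchy net; the set of these is $\mathcal{I}X$, a $[0,1]$-enriched category with $\mathcal{I}X(\phi_1,\phi_2)=\inf_{x\in X}(\phi_1(x)\to\phi_2(x))$. $X$ is Yoneda complete if every forward Cauchy ideal has a colimit; continuous if $\operatorname{colim}:\mathcal{I}X\to X$ has a left adjoint; a $[0,1]$-enriched domain if both. The way below distributor is $\mathfrak{w}(y,x)=\inf_{\phi\in\mathcal{I}X}(X(x,\operatorname{colim}\phi)\to\phi(y))$. Definition of $\Phi_u$: for $p_2\in(0,1]$ and $r_2\in[-M,M]$ let $\mathcal{E}^\ell_{p_2,r_2}(x)=0$ for $x<-M$, $=p_2$ for $-M\le x<r_2$, $=1$ for $x\ge r_2$. For $u\in\mathbb{E}^1_{[-M,M]}$ define $D_u^0\subseteq\mathbb{E}^1_{[-M,M]}$ as follows. If $u_1^->-M$, $D_u^0$ consists of all $w$ with $w^\ell=\mathcal{E}^\ell_{p_2,r_2}$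 and $w^r(x)=1$ for $x\le r_2$, $w^r(x)=p_1$ for $r_2<x\le r_1$, $w^r(x)=0$ for $x>r_1$, where $r_2<r_1$ in $[-M,M]$ are continuity points (as functions on $\mathbb{R}$) of $u^\ell$ and $u^r$ respectively, $u^\ell(r_2)<p_2<1$ and $0<p_1<u^r(r_1)$. If $u_1^-=-M$, $D_u^0$ consists of all $w$ with $w^\ell=\mathcal{E}^\ell_{1,-M}$ and $w^r(x)=1$ for $x\le-M$, $w^r(x)=p_1$ for $-M<x\le r_1$, $w^r(x)=0$ for $x>r_1$, where $r_1\in[-M,M]$ is a continuity point of $u^r$ and $0<p_1<u^r(r_1)$. For $u\neq\chi_{-M}$ (the characteristic function of $\{-M\}$), $D_u$ is the set of all joins $\bigvee_{k=1}^n b_k$ in $(\mathbb{E}^1_{[-M,M]})_0$ with $n\ge1$ and $b_k\in D_u^0$. Finally, $\Phi_u(v)=P(v,u)$ if $u=\lim\big(\sup_{e\in\mathbb{E}^1_{[-M,M]}}P(e,-)\big)$ (i.e. $u$ is the limit of that coweight, which is $\chi_{-M}$), and $\Phi_u(v)=\sup_{w\in D_u}P(v,w)$ otherwise. *)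

(* Defs.v *)
From HB Require Import structures.
From mathcomp Require Import all_boot all_order all_algebra.
From mathcomp Require Import all_classical all_reals all_analysis.

Set Implicit Arguments.
Unset Strict Implicit.
Unset Printing Implicit Defensive.

Import Order.TTheory GRing.Theory Num.Theory.
Import numFieldNormedType.Exports.

Local Open Scope classical_set_scope.
Local Open Scope ring_scope.

(* The quantale [0,1] is represented inside R : operations on [0,1] are        *)
(* functions on R about which nothing is assumed outside [0,1], and all        *)
(* [0,1]-valued maps are R-valued maps whose range is required to be in [0,1]. *)
(* All sup and inf below are of nonempty subsets of [0,1] whenever they are    *)
(* used, so the real sup and inf are the ones of the complete lattice [0,1].   *)
Definition I01 (R : realType) : set R := [set x | 0 <= x <= 1].
Arguments I01 {R}.

Definition unit_valued (R : realType) (X : Type) (f : X -> R) : Prop :=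
  forall x, I01 (f x).

Record is_tnorm (R : realType) (T : R -> R -> R) : Prop := IsTnorm {
  tnorm_closed : forall x y, I01 x -> I01 y -> I01 (T x y) ;
  tnorm_comm : forall x y, I01 x -> I01 y -> T x y = T y x ;
  tnorm_assoc : forall x y z, I01 x -> I01 y -> I01 z ->
    T x (T y z) = T (T x y) z ;
  tnorm_mono : forall x x' y y', I01 x -> I01 x' -> I01 y -> I01 y' ->
    x <= x' -> y <= y' -> T x y <= T x' y' ;
  tnorm_unit : forall x, I01 x -> T x 1 = x }.

Definition continuous_tnorm (R : realType) (T : R -> R -> R) : Prop :=
  is_tnorm T /\
  {within I01 `*` I01, continuous (fun z : R * R => T z.1 z.2)}.

Definition res (R : realType) (T : R -> R -> R) (x y : R) : R :=
  sup [set t | I01 t /\ T x t <= y].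

Definition idempotent_pt (R : realType) (T : R -> R -> R) (x : R) : Prop :=
  I01 x /\ T x x = x.

Definition greatest_idem_below (R : realType) (T : R -> R -> R) (p a : R) :
    Prop :=
  [/\ idempotent_pt T a, a <= p &
      forall b, idempotent_pt T b -> b <= p -> b <= a].

Definition least_idem_above (R : realType) (T : R -> R -> R) (p a : R) : Prop :=
  [/\ idempotent_pt T a, p <= a &
      forall b, idempotent_pt T b -> p <= b -> a <= b].

Definition isomorphic_to_product (R : realType) (T : R -> R -> R) (a b : R) :
    Prop :=
  exists f : R -> R,
    [/\ set_bij `[a, b] I01 f,
        {in `[a, b] &, {mono f : x y / x <= y}} &
        {in `[a, b] &, forall x y, f (T x y) = f x * f y}].

Definition S_summands (R : realType) (T : R -> R -> R) : Prop :=
  forall p a b, I01 p -> ~ idempotent_pt T p ->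
    greatest_idem_below T p a -> least_idem_above T p b ->
    0 < a -> isomorphic_to_product T a b.

Definition S_off_diagonal (R : realType) (T : R -> R -> R) : Prop :=
  forall x y : R, I01 x -> I01 y -> x <> y ->
    res T z.1 z.2 @[z --> within (I01 `*` I01) (nbhs (x, y))] --> res T x y.

Definition S_sections (R : realType) (T : R -> R -> R) : Prop :=
  forall p : R, 0 < p <= 1 -> {within `[0, p[, continuous (res T p)}.

(* The three conditions are equivalent for continuous t-norms; the disjunction *)
(* lets a t-norm qualify through any one of them.                              *)
Definition S_condition (R : realType) (T : R -> R -> R) : Prop :=
  [\/ S_summands T, S_off_diagonal T | S_sections T].

Definition is_encat (R : realType) (T : R -> R -> R) (X : Type)
    (hom : X -> X -> R) : Prop :=
  [/\ forall x y, I01 (hom x y),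
      forall x, hom x x = 1 &
      forall x y z, T (hom y z) (hom x y) <= hom x z].

Definition is_functor (R : realType) (X Y : Type)
    (homX : X -> X -> R) (homY : Y -> Y -> R) (f : X -> Y) : Prop :=
  forall x y, homX x y <= homY (f x) (f y).

Definition left_adjoint (R : realType) (X Y : Type)
    (homX : X -> X -> R) (homY : Y -> Y -> R) (f : X -> Y) (g : Y -> X) : Prop :=
  [/\ is_functor homX homY f, is_functor homY homX g &
      forall x y, homY (f x) y = homX x (g y)].

Definition is_weight (R : realType) (T : R -> R -> R) (X : Type)
    (hom : X -> X -> R) (phi : X -> R) : Prop :=
  unit_valued phi /\ forall x y, hom y x <= res T (phi x) (phi y).

Definition is_colimit (R : realType) (T : R -> R -> R) (X : Type)
    (hom : X -> X -> R) (phi : X -> R) (c : X) : Prop :=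
  forall x, hom c x = inf (range (fun y => res T (phi y) (hom y x))).

Definition is_limit (R : realType) (T : R -> R -> R) (X : Type)
    (hom : X -> X -> R) (psi : X -> R) (l : X) : Prop :=
  forall x, hom x l = inf (range (fun y => res T (psi y) (hom x y))).

Record directed (D : Type) (le : D -> D -> Prop) : Prop := Directed {
  directed_inh : inhabited D ;
  directed_refl : forall i, le i i ;
  directed_trans : forall i j k, le i j -> le j k -> le i k ;
  directed_ub : forall i j, exists k, le i k /\ le j k }.

Definition forward_Cauchy (R : realType) (X : Type) (hom : X -> X -> R)
    (D : Type) (le : D -> D -> Prop) (x : D -> X) : Prop :=
  sup (range (fun i =>
    inf [set hom (x jk.1) (x jk.2) | jk in [set jk | le i jk.1 /\ le jk.1 jk.2]]))
  = 1.

Definition net_weight (R : realType) (X : Type) (hom : X -> X -> R)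
    (D : Type) (le : D -> D -> Prop) (x : D -> X) (y : X) : R :=
  sup (range (fun i => inf [set hom y (x j) | j in le i])).

Definition is_fc_ideal (R : realType) (T : R -> R -> R) (X : Type)
    (hom : X -> X -> R) (phi : X -> R) : Prop :=
  is_weight T hom phi /\
  exists (D : Type) (le : D -> D -> Prop) (x : D -> X),
    [/\ directed le, forward_Cauchy hom le x & phi = net_weight hom le x].

Record fc_ideal (R : realType) (T : R -> R -> R) (X : Type)
    (hom : X -> X -> R) := FcIdeal {
  fc_ideal_fun :> X -> R ;
  fc_idealP : is_fc_ideal T hom fc_ideal_fun }.

Definition ideal_hom (R : realType) (T : R -> R -> R) (X : Type)
    (hom : X -> X -> R) (phi1 phi2 : fc_ideal T hom) : R :=
  inf (range (fun x => res T (phi1 x) (phi2 x))).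

Definition yoneda_complete (R : realType) (T : R -> R -> R) (X : Type)
    (hom : X -> X -> R) : Prop :=
  forall phi : fc_ideal T hom, exists c, is_colimit T hom phi c.

Definition colim (R : realType) (T : R -> R -> R) (X : Type)
    (hom : X -> X -> R) (Y : yoneda_complete T hom) (phi : fc_ideal T hom) : X :=
  sval (cid (Y phi)).

Definition continuous_encat (R : realType) (T : R -> R -> R) (X : Type)
    (hom : X -> X -> R) (Y : yoneda_complete T hom) : Prop :=
  exists t : X -> fc_ideal T hom,
    left_adjoint hom (@ideal_hom R T X hom) t (colim Y).

Record enriched_domain (R : realType) (T : R -> R -> R) (X : Type)
    (hom : X -> X -> R) : Prop := EnrichedDomain {
  domain_encat : is_encat T hom ;
  domain_complete : yoneda_complete T hom ;
  domain_continuous : continuous_encat domain_complete }.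

Definition way_below (R : realType) (T : R -> R -> R) (X : Type)
    (hom : X -> X -> R) (Y : yoneda_complete T hom) (y x : X) : R :=
  inf (range (fun phi : fc_ideal T hom => res T (hom x (colim Y phi)) (phi y))).

Definition upper_semicontinuous (R : realType) (u : R -> R) : Prop :=
  forall x a, u x < a -> \forall y \near x, u y < a.

Definition supp (R : realType) (u : R -> R) : set R :=
  closure [set x | 0 < u x].

Record fuzzy_number (R : realType) := FuzzyNumber {
  fuzzy_fun :> R -> R ;
  fuzzy_unit_valued : unit_valued fuzzy_fun ;
  fuzzy_normal : exists x0, fuzzy_fun x0 = 1 ;
  fuzzy_convex : forall x y l : R, I01 l ->
    Order.min (fuzzy_fun x) (fuzzy_fun y) <= fuzzy_fun (l * x + (1 - l) * y) ;
  fuzzy_usc : upper_semicontinuous fuzzy_fun ;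
  fuzzy_compact : compact (supp fuzzy_fun) }.

Definition core (R : realType) (u : R -> R) : set R := [set x | 1 <= u x].

(* [u]_0 is supp u and [u]_1 is core u, so that u_0^- = inf (supp u),          *)
(* u_0^+ = sup (supp u) and u_1^- = inf (core u).                              *)
Definition left_part (R : realType) (u : R -> R) (x : R) : R :=
  if x < inf (supp u) then 0 else if x <= inf (core u) then u x else 1.

Definition right_part (R : realType) (u : R -> R) (x : R) : R :=
  if x < inf (core u) then 1 else if x <= sup (supp u) then u x else 0.

Record fuzzy_on (R : realType) (M : R) := FuzzyOn {
  fuzzy_on_number :> fuzzy_number R ;
  fuzzy_on_supp : supp fuzzy_on_number `<=` `[- M, M] }.

Definition P_hom (R : realType) (T : R -> R -> R) (u v : fuzzy_number R) : R :=
  inf (range (fun x => Order.min (res T (left_part v x) (left_part u x))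
                                 (res T (right_part u x) (right_part v x)))).

Definition PM (R : realType) (T : R -> R -> R) (M : R) (u v : fuzzy_on M) : R :=
  P_hom T u v.

Definition sqle (R : realType) (T : R -> R -> R) (M : R) (u v : fuzzy_on M) :
    Prop :=
  PM T u v = 1.

Definition is_join (R : realType) (T : R -> R -> R) (M : R) (n : nat)
    (b : 'I_n -> fuzzy_on M) (w : fuzzy_on M) : Prop :=
  (forall k, sqle T (b k) w) /\
  (forall z, (forall k, sqle T (b k) z) -> sqle T w z).

Definition step_left (R : realType) (M p2 r2 x : R) : R :=
  if x < - M then 0 else if x < r2 then p2 else 1.

Definition step_right (R : realType) (r2 p1 r1 x : R) : R :=
  if x <= r2 then 1 else if x <= r1 then p1 else 0.

Definition D0 (R : realType) (M : R) (u : fuzzy_on M) : set (fuzzy_on M) :=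
  [set w |
    (- M < inf (core u) /\
     exists p1 p2 r1 r2 : R,
       [/\ - M <= r2 <= M /\ - M <= r1 <= M, r2 < r1,
           {for r2, continuous (left_part u)} /\
           {for r1, continuous (right_part u)},
           left_part u r2 < p2 < 1 /\ 0 < p1 < right_part u r1 &
           left_part w = step_left M p2 r2 /\
           right_part w = step_right r2 p1 r1])
    \/
    (inf (core u) = - M /\
     exists p1 r1 : R,
       [/\ - M <= r1 <= M,
           {for r1, continuous (right_part u)},
           0 < p1 < right_part u r1 &
           left_part w = step_left M 1 (- M) /\
           right_part w = step_right (- M) p1 r1])].

Definition Djoin (R : realType) (T : R -> R -> R) (M : R) (u : fuzzy_on M) :
    set (fuzzy_on M) :=
  [set w | exists (n : nat) (b : 'I_n -> fuzzy_on M),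
    [/\ (1 <= n)%N, forall k, D0 u (b k) & is_join T b w]].

Definition sup_coweight (R : realType) (T : R -> R -> R) (M : R)
    (v : fuzzy_on M) : R :=
  sup (range (fun e : fuzzy_on M => PM T e v)).

(* A limit in fuzzy_on M is unique, so is_limit ... u says that u is the       *)
(* limit of the coweight.                                                      *)
Definition Phi (R : realType) (T : R -> R -> R) (M : R) (u v : fuzzy_on M) : R :=
  if pselect (is_limit T (@PM R T M) (@sup_coweight R T M) u)
  then PM T v u
  else sup [set PM T v w | w in Djoin T u].

(* Main.v *)
Require Import Defs.
From mathcomp Require Import all_boot all_order all_algebra.
From mathcomp Require Import all_classical all_reals all_analysis.
From mathcomp Require Import ring lra.

Set Implicit Arguments.
Unset Strict Implicit.
Unset Printing Implicit Defensive.

Import Order.TTheory GRing.Theory Num.Theory.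
Import numFieldNormedType.Exports.

Local Open Scope classical_set_scope.
Local Open Scope ring_scope.

(** A fuzzy number supported in [-M, M] is the same thing as a pair made of a
    nondecreasing and a nonincreasing upper semicontinuous function such that
    at each point where the first is below 1 the second equals 1
    ([profile_of_fuzzy], [fuzzy_of_profile]).  In these terms b <= P(u, v) means
    that b & v^l <= u^l and b & u^r <= v^r pointwise ([PMP]), and P is handled
    through these inequalities.

    A forward Cauchy net has a colimit: its left part is the limsup of the left
    parts, regularised from the right, and its right part is the liminf of the
    right parts, regularised from the left.  Hence a strict upper bound of
    the left part of the colimit at t is eventually an upper bound of the left
    parts of the net at t, and a strict lower bound of the right part of the
    colimit beyond t is eventually a lower bound of the right parts of the net
    at t ([net_colimit]).

    The domain structure then follows from a general criterion
    ([domain_of_directed_bases]): it is enough to find, for each u, a directed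
    set B(u) such that P(u, colim psi) is the infimum of psi over B(u), for every
    forward Cauchy ideal psi.  The ideal generated by B(u) is then the value at
    u of the left adjoint of colim, hence also the way below weight of u.

    The set B(u) is D_u, or {u} when u is the bottom element.  One inequality
    says that u is approximated by the step numbers of D_u^0; it holds because
    the continuity points of monotone functions are dense ([D0_dense]).  The
    other one says that P(u, colim psi) <= psi(w) for w in D_u^0
    ([way_below_step]).  All heights and jump points of w are strictly inside
    those of u, and the argument consumes this slack.  For the left part
    continuity of & is enough, but for the right part one needs that
    b' & p' < b & p whenever b' < b and p' < p, unless b' & p' = 0
    ([T_strict]).  This is precisely what the (S) condition provides: the only
    obstruction is a nilpotent summand whose lower end is positive. *)

(** * Suprema and infima in the unit interval, continuous t-norms *)

Section UnitInterval.
Context {R : realType}.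
Implicit Types (x y z b : R) (A : set R).

Lemma I01_ge0 x : I01 x -> 0 <= x.
Proof. by case/andP. Qed.

Lemma I01_le1 x : I01 x -> x <= 1.
Proof. by case/andP. Qed.

Lemma I01_mk x : 0 <= x -> x <= 1 -> I01 x.
Proof. by move=> x0 x1; apply/andP. Qed.

Lemma I01_0 : I01 (0 : R).
Proof. by apply: I01_mk. Qed.

Lemma I01_1 : I01 (1 : R).
Proof. by apply: I01_mk. Qed.

Lemma le_by_lt x y : (forall z, z < x -> z <= y) -> x <= y.
Proof.
move=> h; rewrite leNgt; apply/negP => yx.
by have := h ((x + y) / 2); lra.
Qed.

Lemma le_by_lt01 x y : I01 x -> 0 <= y -> (forall z, I01 z -> z < x -> z <= y) -> x <= y.
Proof.
move=> hx y0 h; apply: le_by_lt => z zx; case: (leP 0 z) => [z0|]; last by lra.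
by apply: h => //; apply: I01_mk => //; apply: le_trans (ltW zx) (I01_le1 hx).
Qed.

Lemma ge_by_gt x y : (forall z, y < z -> x <= z) -> x <= y.
Proof.
move=> h; rewrite leNgt; apply/negP => yx.
by have := h ((x + y) / 2); lra.
Qed.

Lemma eq_by_le01 x y : I01 x -> I01 y ->
  (forall b, I01 b -> (b <= x <-> b <= y)) -> x = y.
Proof.
move=> hx hy h; apply/eqP; rewrite eq_le.
by have [/(_ (lexx _)) -> _] := h x hx; have [_ /(_ (lexx _)) ->] := h y hy.
Qed.

Section Bounds.
Context {A : set R}.
Hypotheses (A01 : A `<=` I01) (A0 : A !=set0).

Lemma has_inf01 : has_inf A.
Proof. by split=> //; exists 0 => x /A01/I01_ge0. Qed.

Lemma has_sup01 : has_sup A.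
Proof. by split=> //; exists 1 => x /A01/I01_le1. Qed.

Lemma inf01_le x : A x -> inf A <= x.
Proof. by move=> Ax; apply: ge_inf => //; case: has_inf01. Qed.

Lemma sup01_ge x : A x -> x <= sup A.
Proof. by move=> Ax; apply: ub_le_sup => //; case: has_sup01. Qed.

Lemma inf01P b : b <= inf A <-> forall x, A x -> b <= x.
Proof.
split=> [h x Ax|h]; first exact: le_trans h (inf01_le Ax).
exact: lb_le_inf.
Qed.

Lemma sup01P b : sup A <= b <-> forall x, A x -> x <= b.
Proof.
split=> [h x Ax|h]; first exact: le_trans (sup01_ge Ax) h.
exact: ge_sup.
Qed.

Lemma inf01_lt b : inf A < b -> exists2 x, A x & x < b.
Proof.
move=> h; have [x Ax] := @inf_adherent R A (b - inf A) ltac:(lra) has_inf01.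
by rewrite addrC subrK; exists x.
Qed.

Lemma sup01_gt b : b < sup A -> exists2 x, A x & b < x.
Proof.
move=> h; have [x Ax] := @sup_adherent R A (sup A - b) ltac:(lra) has_sup01.
by rewrite subKr; exists x.
Qed.

Lemma inf01 : I01 (inf A).
Proof.
apply: I01_mk; first by apply/inf01P => x /A01/I01_ge0.
by case: A0 => x Ax; apply: le_trans (inf01_le Ax) (I01_le1 (A01 Ax)).
Qed.

Lemma sup01 : I01 (sup A).
Proof.
apply: I01_mk; last by apply/sup01P => x /A01/I01_le1.
by case: A0 => x Ax; apply: le_trans (I01_ge0 (A01 Ax)) (sup01_ge Ax).
Qed.

End Bounds.

Section RangeBounds.
Context {I : Type} {f : I -> R}.
Hypothesis f01 : unit_valued f.

Let range01 : range f `<=` I01.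
Proof. by move=> _ [i _ <-]. Qed.

Let range0 (i : I) : range f !=set0.
Proof. by exists (f i), i. Qed.

Lemma inf_range01 (i : I) : I01 (inf (range f)).
Proof. exact: inf01 range01 (range0 i). Qed.

Lemma sup_range01 (i : I) : I01 (sup (range f)).
Proof. exact: sup01 range01 (range0 i). Qed.

Lemma inf_rangeP (i : I) b : b <= inf (range f) <-> forall i, b <= f i.
Proof.
rewrite (inf01P range01 (range0 i)); split=> [h j|h _ [j _ <-]//].
by apply: h; exists j.
Qed.

Lemma inf_range_le (i : I) : inf (range f) <= f i.
Proof. by apply: inf01_le (range0 i) _ _ => //; exists i. Qed.

Lemma sup_range_ge (i : I) : f i <= sup (range f).
Proof. by apply: sup01_ge (range0 i) _ _ => //; exists i. Qed.

Lemma sup_range_gt (i : I) b : b < sup (range f) -> exists i, b < f i.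
Proof. by move=> /(sup01_gt range01 (range0 i))[_ [j _ <-]]; exists j. Qed.

End RangeBounds.

End UnitInterval.

Section ContinuousTnorm.
Context {R : realType} {T : R -> R -> R}.
Hypothesis hT : continuous_tnorm T.
Implicit Types x y z a b c t : R.

Lemma T01 x y : I01 x -> I01 y -> I01 (T x y).
Proof. exact: tnorm_closed hT.1 _ _. Qed.

Lemma TC x y : I01 x -> I01 y -> T x y = T y x.
Proof. exact: tnorm_comm hT.1 _ _. Qed.

Lemma TA x y z : I01 x -> I01 y -> I01 z -> T x (T y z) = T (T x y) z.
Proof. exact: tnorm_assoc hT.1 _ _ _. Qed.

Lemma T_le x x' y y' : I01 x -> I01 x' -> I01 y -> I01 y' ->
  x <= x' -> y <= y' -> T x y <= T x' y'.
Proof. exact: tnorm_mono hT.1 _ _ _ _. Qed.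

Lemma Tx1 x : I01 x -> T x 1 = x.
Proof. exact: tnorm_unit hT.1 _. Qed.

Lemma T1x x : I01 x -> T 1 x = x.
Proof. by move=> hx; rewrite TC ?Tx1 //; apply: I01_1. Qed.

Lemma T_le_r x y : I01 x -> I01 y -> T x y <= y.
Proof.
move=> hx hy; rewrite -[leRHS]T1x //; apply: T_le => //; first exact: I01_1.
exact: I01_le1.
Qed.

Lemma T_le_l x y : I01 x -> I01 y -> T x y <= x.
Proof. by move=> hx hy; rewrite TC //; apply: T_le_r. Qed.

Lemma Tx0 x : I01 x -> T x 0 = 0.
Proof.
move=> hx; apply/eqP; rewrite eq_le T_le_r //=; last exact: I01_0.
exact: I01_ge0 (T01 hx I01_0).
Qed.

Lemma T_cont a b e : I01 a -> I01 b -> 0 < e ->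
  exists2 d, 0 < d & forall b', I01 b' -> `|b - b'| < d -> `|T a b - T a b'| < e.
Proof.
move=> ha hb e0.
have /subspace_continuousP/(_ (a, b) (conj ha hb)) := hT.2.
move=> /cvgrPdist_lt/(_ e e0); rewrite near_withinE => /nbhs_ballP[d /= d0 h].
exists d => // b' hb' bb'; apply: (h (a, b')) => //.
by split => //=; apply: ballxx.
Qed.

(** Left continuity of a & -, as an induction principle for upper bounds. *)
Lemma T_le_lim a b c : I01 a -> I01 b -> 0 <= c ->
  (forall b', I01 b' -> b' < b -> T a b' <= c) -> T a b <= c.
Proof.
move=> ha hb c0 h; case: (leP b 0) => [b0|b0].
  have -> : b = 0 by apply: le_anti; rewrite b0 I01_ge0.
  by rewrite Tx0.
rewrite leNgt; apply/negP => cT.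
have [d d0 {}hd] := @T_cont a b (T a b - c) ha hb ltac:(lra).
have b1 := I01_le1 hb.
(* b may be 0 or close to it, so b - d / 2 is truncated at 0 *)
pose b' := Num.max 0 (b - d / 2).
have b'b : b' < b by rewrite gt_max b0 /=; lra.
have hb' : I01 b' by apply: I01_mk; [rewrite le_max lexx | lra].
have : b - d / 2 <= b' by rewrite le_max lexx orbT.
move=> b'd; have := h b' hb' b'b.
have : `|b - b'| < d by rewrite ger0_norm; lra.
by move=> /(hd _ hb'); rewrite ltr_norml => /andP[]; lra.
Qed.

(** Right continuity of a & -. *)
Lemma T_lt_nbhs a b c : I01 a -> I01 b -> T a b < c ->
  exists2 d, b < d & forall x, I01 x -> x < d -> T a x < c.
Proof.
move=> ha hb Tc; have [d d0 hd] := @T_cont a b (c - T a b) ha hb ltac:(lra).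
exists (b + d) => [|x hx xd]; first lra.
case: (leP x b) => xb; first by apply: le_lt_trans Tc; apply: T_le.
have : `|b - x| < d by rewrite ler0_norm; lra.
by move=> /(hd _ hx); rewrite ltr_norml => /andP[]; lra.
Qed.

Let res_set01 x y : [set t | I01 t /\ T x t <= y] `<=` I01.
Proof. by move=> t []. Qed.

Let res_set0 x y : I01 x -> 0 <= y -> [set t | I01 t /\ T x t <= y] !=set0.
Proof. by move=> hx y0; exists 0; split; rewrite ?Tx0 //; apply: I01_0. Qed.

Lemma res01 x y : I01 x -> I01 y -> I01 (res T x y).
Proof. by move=> hx /I01_ge0 y0; apply: sup01 (@res_set01 x y) (res_set0 hx y0). Qed.

(** The residuation law holds because a & - preserves suprema. *)
Lemma resP t x y : I01 t -> I01 x -> I01 y -> (t <= res T x y) <-> (T x t <= y).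
Proof.
move=> ht hx hy; have y0 := I01_ge0 hy.
split=> [h|h]; last first.
  exact: sup01_ge (@res_set01 x y) (res_set0 hx y0) _ _.
apply: T_le_lim => // t' ht' t't.
have [s [hs sy] ts] :=
  sup01_gt (@res_set01 x y) (res_set0 hx y0) (lt_le_trans t't h).
by apply: le_trans sy; apply: T_le => //; exact: ltW.
Qed.

Lemma T_res x y : I01 x -> I01 y -> T x (res T x y) <= y.
Proof. by move=> hx hy; apply/resP => //; apply: res01. Qed.

Lemma res1x y : I01 y -> res T 1 y = y.
Proof.
move=> hy; have h1 := @I01_1 R; apply: eq_by_le01 => // [|b hb]; first exact: res01.
by rewrite resP // T1x.
Qed.

End ContinuousTnorm.

(** * The (S) condition as strict monotonicity *)

Section StrictMonotonicity.
Context {R : realType} {T : R -> R -> R}.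
Hypothesis hT : continuous_tnorm T.
Implicit Types x y z a b c t : R.

(** Continuity of & at the residual value z: if a & z were below y, z could be enlarged. *)
Lemma T_surj a y : I01 a -> I01 y -> y <= a -> exists2 z, I01 z & T a z = y.
Proof.
move=> ha hy ya; have hz := res01 hT ha hy; exists (res T a y) => //.
apply/eqP; rewrite eq_le (T_res hT) //= leNgt; apply/negP => lt_y.
have [d zd hd] := T_lt_nbhs hT ha hz lt_y.
have z1 : res T a y < 1.
  rewrite lt_neqAle (I01_le1 hz) andbT; apply/eqP => z1.
  by move: lt_y; rewrite z1 (Tx1 hT) // ltNge ya.
have [x xz [xd x1]] : exists2 x, res T a y < x & x < d /\ x <= 1.
  exists (Num.min 1 ((res T a y + d) / 2)).
    by rewrite lt_min z1 /=; lra.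
  by split; rewrite ?ge_min ?lexx // gt_min; apply/orP; right; lra.
have hx : I01 x by apply: I01_mk => //; have := I01_ge0 hz; lra.
by have := ltW (hd x hx xd); move/(resP hT hx ha hy); lra.
Qed.

(** By divisibility y = e & z for some z, and e & e = e. *)
Lemma T_idem_unit e y : idempotent_pt T e -> I01 y -> y <= e -> T e y = y.
Proof.
move=> [he ee] hy ye; have [z hz <-] := T_surj he hy ye.
by rewrite (TA hT) // ee.
Qed.

(** The stabiliser of L is closed under & and has a least element by
    continuity; minimality makes that element idempotent. *)
Lemma T_stable_idem L s : I01 L -> I01 s -> T L s = L ->
  exists e, [/\ idempotent_pt T e, L <= e & e <= s].
Proof.
move=> hL hs Ls; pose E := [set t | I01 t /\ T L t = L].
have E01 : E `<=` I01 by move=> t [].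
have E0 : E !=set0 by exists s.
have he := inf01 E01 E0; set e := inf E in he.
have Le : T L e = L.
  apply/eqP; rewrite eq_le (T_le_l hT) //= leNgt; apply/negP => lt_L.
  have [d ed hd] := T_lt_nbhs hT hL he lt_L.
  have [x [hx Lx] xd] := inf01_lt E01 E0 ed.
  by have := hd x hx xd; rewrite Lx ltxx.
have hee := T01 hT he he.
exists e; split; last by apply: inf01_le.
  split=> //; apply/eqP; rewrite eq_le (T_le_l hT) //=.
  by apply: inf01_le => //; split=> //; rewrite (TA hT) // Le.
by rewrite -[leLHS]Le (T_le_r hT).
Qed.

(** The infimum c of the idempotents above m is idempotent: it is a limit of
    such b, and each of them satisfies b & c = c. *)
Lemma least_idem_aboveE m : I01 m -> exists c, least_idem_above T m c.
Proof.
move=> hm; pose B := [set b | idempotent_pt T b /\ m <= b].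
have B01 : B `<=` I01 by move=> t [[]].
have B0 : B !=set0.
  exists 1; split; last exact: I01_le1.
  by split; rewrite ?(Tx1 hT) //; apply: I01_1.
have hc := inf01 B01 B0; exists (inf B); set c := inf B in hc *.
have cB b : B b -> c <= b by move=> Bb; apply: inf01_le.
split; last by move=> b ib mb; apply: cB.
  split=> //; apply/eqP; rewrite eq_le (T_le_l hT) //= leNgt; apply/negP => lt_c.
  have [d cd hd] := T_lt_nbhs hT hc hc lt_c.
  have [b Bb bd] := inf01_lt B01 B0 cd; have [[hb bb] mb] := Bb.
  have := hd b hb bd; rewrite (TC hT) // T_idem_unit ?ltxx //; exact: cB.
by apply/(inf01P B01 B0) => b [].
Qed.

(** Write a' = a & z and p' = p & w.  Then the common value L satisfies
    L = L & (z & w), so L is below an idempotent e under z and w.  This e lies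
    strictly below a and p, for otherwise z or w would act as a unit on a or p;
    hence e = e & e <= a & p = L. *)
Lemma T_collapse_idem a a' p p' : I01 a -> I01 a' -> I01 p -> I01 p' ->
  a' < a -> p' < p -> T a' p' = T a p ->
  idempotent_pt T (T a p) /\ T a p < Num.min a p.
Proof.
move=> ha ha' hp hp' aa pp eqT.
have [z hz az] := T_surj ha ha' (ltW aa).
have [w hw pw] := T_surj hp hp' (ltW pp).
have hL := T01 hT ha hp; set L := T a p in eqT hL *.
have hs := T01 hT hz hw.
have Ls : T L (T z w) = L.
  rewrite -[RHS]eqT -az -pw /L.
  rewrite -!(TA hT) //; try exact: T01.
  congr (T a _); rewrite !(TA hT) //; congr (T _ w); exact: TC.
have [e [ie Le es]] := T_stable_idem hL hs Ls.
have he := ie.1.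
(* if x <= e <= y, then y would act as a unit on x *)
have lt_e x x' y : I01 x -> I01 x' -> I01 y -> T x y = x' -> x' < x -> e <= y -> e < x.
  move=> hx hx' hy xy xx ey; rewrite ltNge; apply/negP => xe.
  have : T x e <= T x y by apply: T_le.
  by rewrite xy (TC hT) // T_idem_unit // leNgt xx.
have ea : e < a.
  by apply: lt_e az aa _ => //; apply: le_trans es _; apply: T_le_l.
have ep : e < p.
  by apply: lt_e pw pp _ => //; apply: le_trans es _; apply: T_le_r.
suff -> : L = e by rewrite lt_min ea ep.
apply/eqP; rewrite eq_le Le /= -ie.2; apply: T_le => //; exact: ltW.
Qed.

(** If L = a & p is positive, it is the lower end of the summand of
    m = min(a, p), and m & m = L.  The product isomorphism sends the
    idempotent L to 0, and then it must send m to 0 as well. *)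
Lemma T_strict_summands a a' p p' : S_summands T ->
  I01 a -> I01 a' -> I01 p -> I01 p' ->
  a' < a -> p' < p -> T a' p' = T a p -> T a p = 0.
Proof.
move=> S ha ha' hp hp' aa pp eqT.
have [iL Lm] := T_collapse_idem ha ha' hp hp' aa pp eqT.
set L := T a p in iL Lm *; have [hL LL] := iL.
apply/eqP; case: (eqVneq L 0) => // Lne0.
have L0 : 0 < L by rewrite lt_neqAle eq_sym Lne0 I01_ge0.
set m := Num.min a p in Lm.
have hm : I01 m by rewrite /m; case: (leP a p).
have mm : T m m = L.
  apply/eqP; rewrite eq_le; apply/andP; split.
    by apply: T_le => //; rewrite ge_min lexx ?orbT.
  by rewrite -[leLHS]LL; apply: T_le => //; apply: ltW.
have nim : ~ idempotent_pt T m by case=> _; rewrite mm => Em; rewrite Em ltxx in Lm.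
have gL : greatest_idem_below T m L.
  split=> //; first exact: ltW.
  by move=> b [hb bb] bm; rewrite -bb -mm; apply: T_le.
have [c lc] := least_idem_aboveE hm.
have [f [[f01 _ _] fmono fM]] := S m L c hm nim gL lc L0.
have [_ mc _] := lc.
have Li : L \in `[L, c] by rewrite in_itv /= lexx /=; lra.
have mi : m \in `[L, c] by rewrite in_itv /= mc ltW.
have fm1 : f m <= 1 by apply: I01_le1; apply: f01.
have fL0 : 0 <= f L by apply: I01_ge0; apply: f01.
have fLm : f L < f m by rewrite (leW_mono_in fmono).
have : f L = f L * f L by rewrite -fM // LL.
have : f L = f m * f m by rewrite -fM // mm.
by nra.
Qed.

(** p -> y is at most a' for y < L, because p & a' is already at least L,
    whereas p -> L is at least a.  As L <= p' < p, the jump is off the diagonal. *)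
Lemma res_jump a a' p p' : I01 a -> I01 a' -> I01 p -> I01 p' ->
  a' < a -> p' < p -> T a' p' = T a p -> 0 < T a p ->
  exists2 e, 0 < e & forall d, 0 < d ->
    exists y, [/\ I01 y, y < T a p, `|T a p - y| < d &
                  e <= `|res T p (T a p) - res T p y| ].
Proof.
move=> ha ha' hp hp' aa pp eqT; have hL := T01 hT ha hp.
set L := T a p in eqT hL * => L0.
exists (a - a') => [|d d0]; first lra.
have [y [hy yL Ly]] : exists y, [/\ I01 y, y < L & `|L - y| < d].
  have L1 := I01_le1 hL.
  (* L - d / 2 need not lie in [0,1], hence the truncation *)
  exists (Num.max 0 (L - d / 2)).
  have m0 : 0 <= Num.max 0 (L - d / 2) by rewrite le_max lexx.
  have mL : L - d / 2 <= Num.max 0 (L - d / 2) by rewrite le_max lexx orbT.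
  have mlt : Num.max 0 (L - d / 2) < L by rewrite gt_max L0 /=; lra.
  split=> //; first by apply: I01_mk => //; lra.
  by rewrite ger0_norm; lra.
exists y; split=> //.
have h1 : a <= res T p L by apply/resP => //; rewrite (TC hT).
have h2 : res T p y <= a'.
  rewrite leNgt; apply/negP => lt_r.
  have : T p' a' <= y.
    apply: le_trans (T_res hT hp hy); apply: T_le; rewrite ?ltW //.
    exact: res01.
  by rewrite (TC hT) // eqT; lra.
by rewrite ger0_norm; lra.
Qed.

(** A common positive value L = a' & p' = a & p contradicts each form of the (S)
    condition: form (i) by [T_strict_summands], forms (ii) and (iii) because
    p -> - jumps at L. *)
Lemma T_strict a a' p p' : S_condition T ->
  I01 a -> I01 a' -> I01 p -> I01 p' -> a' < a -> p' < p ->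
  T a' p' < T a p \/ T a' p' = 0.
Proof.
move=> S ha ha' hp hp' aa pp; have hL := T01 hT ha hp.
have := T_le hT ha' ha hp' hp (ltW aa) (ltW pp).
rewrite le_eqVlt => /orP[/eqP eqT|]; last by left.
right; rewrite eqT; case: (eqVneq (T a p) 0) => // Lne0.
have L0 : 0 < T a p by rewrite lt_neqAle eq_sym Lne0 I01_ge0.
have Lp : T a p < p by rewrite -eqT; apply: le_lt_trans pp; apply: T_le_r.
have [e e0 jump] := res_jump ha ha' hp hp' aa pp eqT L0.
have p0 : 0 < p by apply: lt_trans L0 Lp.
case: S => S.
- exact: T_strict_summands S ha ha' hp hp' aa pp eqT.
- have Lne : p <> T a p by move=> E; move: Lp; rewrite -E ltxx.
  have /cvgrPdist_lt/(_ e e0) := S p (T a p) hp hL Lne.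
  rewrite near_withinE => /nbhs_ballP[d /= d0 hd].
  have [y [hy yL Ly]] := jump d d0.
  by rewrite leNgt; case/negP; apply: (hd (p, y)) => //; split=> //=; exact: ballxx.
- have p1 : 0 < p <= 1 by rewrite p0 (I01_le1 hp).
  have Li : `[0, p[%classic (T a p) by rewrite /= in_itv /= Lp I01_ge0.
  have /subspace_continuousP/(_ _ Li)/cvgrPdist_lt/(_ e e0) := S p p1.
  rewrite near_withinE => /nbhs_ballP[d /= d0 hd].
  have [y [hy yL Ly]] := jump d d0.
  rewrite leNgt; case/negP; apply: (hd y) => //=.
  by rewrite in_itv /= (I01_ge0 hy) /=; lra.
Qed.

End StrictMonotonicity.

(** * Fuzzy numbers as pairs of monotone functions *)

Section Profiles.
Context {R : realType} {M : R}.
Implicit Types (x y z a c t : R) (L Rt : R -> R).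

(** The coupling [profile_lr] replaces the requirement that the two functions
    share a point of value 1: it is local, hence stable under joins and
    limits, and semicontinuity recovers the common point. *)
Record profile L Rt : Prop := Profile {
  profile_l01 : unit_valued L ;
  profile_r01 : unit_valued Rt ;
  profile_l_le : forall x y, x <= y -> L x <= L y ;
  profile_r_le : forall x y, x <= y -> Rt y <= Rt x ;
  profile_l_usc : forall x a, L x < a -> exists2 y, x < y & L y < a ;
  profile_r_usc : forall x a, Rt x < a -> exists2 y, y < x & Rt y < a ;
  profile_l0 : forall x, x < - M -> L x = 0 ;
  profile_l1 : forall x, M <= x -> L x = 1 ;
  profile_r1 : forall x, x <= - M -> Rt x = 1 ;
  profile_r0 : forall x, M < x -> Rt x = 0 ;
  profile_lr : forall x, L x < 1 -> Rt x = 1 }.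

Lemma usc_ball (u : R -> R) x a : upper_semicontinuous u -> u x < a ->
  exists2 d, 0 < d & forall y, `|x - y| < d -> u y < a.
Proof. by move=> usc /usc/nbhs_ballP[d /= d0 hd]; exists d. Qed.

Section FromProfile.
Context {L Rt : R -> R}.
Hypothesis h : profile L Rt.

Let u x := Num.min (L x) (Rt x).

Let u01 : unit_valued u.
Proof.
by move=> x; rewrite /u; case: leP => _; [apply: profile_l01 h _|apply: profile_r01 h _].
Qed.

Let top := [set x | L x = 1].

Let top_has_inf : has_inf top.
Proof.
split; first by exists M; apply: profile_l1 h _ _.
exists (- M) => x Lx; rewrite leNgt; apply/negP => /(profile_l0 h).
by rewrite Lx => /eqP; rewrite oner_eq0.
Qed.

Let c := inf top.

Let L_c : L c = 1.
Proof.
apply/eqP; rewrite eq_le (I01_le1 (profile_l01 h _)) /= leNgt; apply/negP.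
move=> /(profile_l_usc h)[y cy Ly].
have [x Lx] := @inf_adherent R top (y - c) ltac:(lra) top_has_inf.
rewrite -/c addrC subrK => xy; have := profile_l_le h (ltW xy).
by rewrite (Lx : L x = 1); lra.
Qed.

Let R_c : Rt c = 1.
Proof.
apply/eqP; rewrite eq_le (I01_le1 (profile_r01 h _)) /= leNgt; apply/negP.
move=> /(profile_r_usc h)[y yc Ry].
have := ge_inf (proj2 top_has_inf); rewrite -/c => /(_ y).
case: (ltP (L y) 1) => [/(profile_lr h)|Ly]; first by lra.
have Ly1 : top y by apply/eqP; rewrite eq_le (I01_le1 (profile_l01 h _)).
by move=> /(_ Ly1); lra.
Qed.

Let L_lt1 x : x < c -> L x < 1.
Proof.
move=> xc; rewrite ltNge; apply/negP => Lx.
have Lx1 : top x by apply/eqP; rewrite eq_le (I01_le1 (profile_l01 h _)).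
by have := ge_inf (proj2 top_has_inf) Lx1; rewrite -/c; lra.
Qed.

Let L_ge1 x : c <= x -> L x = 1.
Proof.
move=> cx; apply/eqP; rewrite eq_le (I01_le1 (profile_l01 h _)) /=.
by rewrite -L_c; apply: profile_l_le h _ _ cx.
Qed.

Let R_le1 x : x <= c -> Rt x = 1.
Proof.
move=> cx; apply/eqP; rewrite eq_le (I01_le1 (profile_r01 h _)) /=.
by rewrite -R_c; apply: profile_r_le h _ _ cx.
Qed.

Let u_convex x y l : I01 l -> Num.min (u x) (u y) <= u (l * x + (1 - l) * y).
Proof.
move=> /andP[l0 l1]; rewrite /u.
wlog xy : x y l l0 l1 / x <= y => [wl|].
  case: (leP x y) => [|/ltW] xy; first exact: wl.
  have := wl y x (1 - l) ltac:(lra) ltac:(lra) xy.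
  by rewrite minC (_ : (1 - l) * y + _ = l * x + (1 - l) * y) //; ring.
have := profile_l_le h (_ : x <= l * x + (1 - l) * y) => /(_ ltac:(nra)) h1.
have := profile_r_le h (_ : l * x + (1 - l) * y <= y) => /(_ ltac:(nra)) h2.
rewrite le_min; apply/andP; split.
  by apply: le_trans h1; rewrite !ge_min lexx.
by apply: le_trans h2; rewrite !ge_min lexx !orbT.
Qed.

Let u_usc : upper_semicontinuous u.
Proof.
move=> x a; rewrite /u gt_min => /orP[/(profile_l_usc h)|/(profile_r_usc h)].
  move=> [y xy Ly]; apply/nbhs_ballP; exists (y - x) => /=; first lra.
  move=> z; rewrite /ball /= ltr_norml => /andP[z1 z2].
  rewrite gt_min; apply/orP; left; apply: le_lt_trans Ly.
  by apply: profile_l_le h _ _ _; lra.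
move=> [y xy Ly]; apply/nbhs_ballP; exists (x - y) => /=; first lra.
move=> z; rewrite /ball /= ltr_norml => /andP[z1 z2].
rewrite gt_min; apply/orP; right; apply: le_lt_trans Ly.
by apply: profile_r_le h _ _ _; lra.
Qed.

Let supp_sub : supp u `<=` `[- M, M].
Proof.
have /closure_id -> : closed (`[- M, M]%classic : set R) by exact: itv_closed.
apply: closure_subset => x; rewrite /= /u lt_min in_itv /= => /andP[Lx Rx].
apply/andP; split; rewrite leNgt; apply/negP => hx.
  by move: Lx; rewrite (profile_l0 h) // ltxx.
by move: Rx; rewrite (profile_r0 h) // ltxx.
Qed.

Let u_compact : compact (supp u).
Proof.
apply: subclosed_compact supp_sub; first exact: closed_closure.
exact: segment_compact.
Qed.

Let fu : fuzzy_number R.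
Proof.
apply: (@FuzzyNumber R u) => //.
by exists c; rewrite /u L_c R_c minxx.
Defined.

Let supp_has x : 0 < u x -> supp u x.
Proof. by move=> ux; apply: subset_closure. Qed.

Let supp_ub : has_ubound (supp u).
Proof. by exists M => x /supp_sub /=; rewrite in_itv /= => /andP[]. Qed.

Let supp_lb : has_lbound (supp u).
Proof. by exists (- M) => x /supp_sub /=; rewrite in_itv /= => /andP[]. Qed.

Let supp_c : supp u c.
Proof. by apply: supp_has; rewrite /u L_c R_c minxx. Qed.

Let core_inf : inf (core u) = c.
Proof.
have cc : core u c by rewrite /core /= /u L_c R_c minxx.
have clb : lbound (core u) c.
  move=> x; rewrite /core /= /u le_min => /andP[Lx _]; rewrite leNgt; apply/negP.
  by move=> /L_lt1; lra.
apply/eqP; rewrite eq_le (ge_inf _ cc) /=; last by exists c.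
by apply: lb_le_inf => //; exists c.
Qed.

(** The fuzzy number is the minimum of the two functions; its core starts at
    the least point c where L is 1, and R is still 1 there by the coupling. *)
Lemma fuzzy_of_profile : exists v : fuzzy_on M, left_part v = L /\ right_part v = Rt.
Proof.
exists (FuzzyOn (fuzzy_on_number := fu) supp_sub); split; apply/funext => x /=.
- rewrite /left_part core_inf; case: ltP => [xs|xs].
    apply/esym/eqP; rewrite eq_le (I01_ge0 (profile_l01 h _)) andbT leNgt.
    apply/negP => Lx; suff /supp_has/(ge_inf supp_lb) : 0 < u x by lra.
    have xc : x <= c by have := ge_inf supp_lb supp_c; lra.
    by rewrite /u R_le1 // lt_min Lx ltr01.
  case: leP => xc; last by rewrite L_ge1 // ltW.
  by rewrite /u R_le1 // min_l // (I01_le1 (profile_l01 h _)).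
- rewrite /right_part core_inf; case: ltP => [xc|cx]; first by rewrite R_le1 // ltW.
  rewrite /u L_ge1 // min_r ?(I01_le1 (profile_r01 h _)) //.
  case: leP => // sx.
  apply/esym/eqP; rewrite eq_le (I01_ge0 (profile_r01 h _)) andbT leNgt.
  apply/negP => Rx; suff /supp_has/(ub_le_sup supp_ub) : 0 < u x by lra.
  by rewrite /u L_ge1 // lt_min Rx ltr01.
Qed.

End FromProfile.

Section ToProfile.
Context {u : fuzzy_on M}.

Let c := inf (core u).

Let supp_has x : 0 < u x -> supp u x.
Proof. by move=> ux; apply: subset_closure. Qed.

Let supp_lb : has_lbound (supp u).
Proof. by exists (- M) => x /(@fuzzy_on_supp _ _ u) /=; rewrite in_itv /= => /andP[]. Qed.

Let supp_ub : has_ubound (supp u).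
Proof. by exists M => x /(@fuzzy_on_supp _ _ u) /=; rewrite in_itv /= => /andP[]. Qed.

Let core_supp x : core u x -> supp u x.
Proof. by rewrite /core /= => ux; apply: supp_has; lra. Qed.

Let u01 := fuzzy_unit_valued u.

Let core_has_inf : has_inf (core u).
Proof.
split; first by have [x ux] := fuzzy_normal u; exists x; rewrite /core /= ux.
by case: supp_lb => a ha; exists a => x /core_supp/ha.
Qed.

Let u_c : u c = 1.
Proof.
apply/eqP; rewrite eq_le (I01_le1 (u01 _)) /= leNgt; apply/negP => uc.
have [d d0 hd] := usc_ball (fuzzy_usc (f := u)) uc.
have [x ux] := inf_adherent d0 core_has_inf; rewrite -/c => xc.
have cx : c <= x by apply: ge_inf ux; case: core_has_inf.
have : u x < 1 by apply: hd; rewrite ler0_norm; lra.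
by move: ux; rewrite /core /=; lra.
Qed.

Let u_lt1 x : x < c -> u x < 1.
Proof.
move=> xc; rewrite ltNge; apply/negP => ux.
by have := ge_inf (proj2 core_has_inf) (ux : core u x); rewrite -/c; lra.
Qed.

Let u_between x y z : x <= y -> y <= z -> Num.min (u x) (u z) <= u y.
Proof.
move=> xy yz; case: (eqVneq x z) => [xz|xz].
  have -> : y = x by lra.
  by rewrite ge_min lexx.
have xz' : 0 < z - x by rewrite subr_gt0 lt_neqAle xz; lra.
have -> : y = ((z - y) / (z - x)) * x + (1 - (z - y) / (z - x)) * z.
  by field; rewrite gt_eqF.
apply: fuzzy_convex; apply: I01_mk; first by rewrite divr_ge0; lra.
by rewrite ler_pdivrMr // mul1r; lra.
Qed.

Let u_incr x y : x <= y -> y <= c -> u x <= u y.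
Proof.
move=> xy yc; have := u_between xy yc; rewrite u_c min_l //.
exact: I01_le1.
Qed.

Let u_decr x y : c <= x -> x <= y -> u y <= u x.
Proof.
move=> cx xy; have := u_between cx xy; rewrite u_c min_r //.
exact: I01_le1.
Qed.

Let supp_c : supp u c.
Proof. by apply: supp_has; rewrite u_c. Qed.

Let u_out x : ~ supp u x -> u x = 0.
Proof.
move=> nx; apply/eqP; rewrite eq_le (I01_ge0 (u01 _)) andbT leNgt.
by apply/negP => /supp_has.
Qed.

(** u vanishes to the left of its support. *)
Lemma left_partE x : left_part u x = if x <= inf (core u) then u x else 1.
Proof.
rewrite /left_part -/c; case: ltP => // xs.
have xc : x <= c by have := ge_inf supp_lb supp_c; lra.
by rewrite xc u_out // => /(ge_inf supp_lb); lra.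
Qed.

Lemma right_partE x : right_part u x = if x < inf (core u) then 1 else u x.
Proof.
rewrite /right_part -/c; case: ltP => // cx; case: leP => // sx.
by rewrite u_out // => /(ub_le_sup supp_ub); lra.
Qed.

Lemma left_part_lt1 x : (left_part u x < 1) = (x < inf (core u)).
Proof.
rewrite left_partE -/c; case: (ltgtP x c) => [/u_lt1->//|xc|->]; first by rewrite ltxx.
by rewrite u_c ltxx.
Qed.

Lemma core_inf_ge : - M <= inf (core u).
Proof. by have := fuzzy_on_supp supp_c; rewrite /= in_itv /= => /andP[]. Qed.

(** Convexity, compared with the value 1 at the start c of the core, makes u
    monotone on each side of c. *)
Lemma profile_of_fuzzy : profile (left_part u) (right_part u).
Proof.
have cM : c <= M by have := fuzzy_on_supp supp_c; rewrite /= in_itv /= => /andP[].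
have Mc : - M <= c := core_inf_ge.
have out x : ~~ (x \in `[- M, M]) -> u x = 0.
  by move=> hx; apply: u_out => /fuzzy_on_supp /=; apply/negP.
split=> [x|x|x y xy|x y xy|x a|x a|x xM|x xM|x xM|x xM|x].
- by rewrite left_partE; case: ifP => _; [apply: u01 | apply: I01_1].
- by rewrite right_partE; case: ifP => _; [apply: I01_1 | apply: u01].
- rewrite !left_partE -/c; case: (leP y c) => yc.
    by rewrite (le_trans xy yc); apply: u_incr.
  by case: ifP => // _; apply: I01_le1.
- rewrite !right_partE -/c; case: (ltP x c) => xc.
    by case: ifP => // _; apply: I01_le1.
  by rewrite ltNge (le_trans xc xy) /=; apply: u_decr.
- rewrite left_partE -/c => ua; case: (ltP x c) => xc.
    rewrite (ltW xc) in ua.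
    have [d d0 hd] := usc_ball (fuzzy_usc (f := u)) ua.
    exists (Num.min c (x + d / 2)); first by rewrite lt_min xc; lra.
    have cd : x < Num.min c (x + d / 2) by rewrite lt_min xc; lra.
    have dd : Num.min c (x + d / 2) <= x + d / 2 by rewrite ge_min lexx orbT.
    rewrite left_partE -/c ge_min lexx /=; apply: hd.
    by rewrite ler0_norm; lra.
  exists (x + 1); first lra.
  rewrite left_partE -/c; have -> : (x + 1 <= c) = false by apply/negP; lra.
  move: ua; case: (leP x c) => // xc'; have -> : x = c by lra.
  by rewrite u_c.
- rewrite right_partE -/c => ua; case: (leP x c) => xc.
    exists (x - 1); first lra.
    rewrite right_partE -/c; have -> : x - 1 < c by lra.
    move: ua; case: (ltP x c) => // xc'; have -> : x = c by lra.
    by rewrite u_c.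
  rewrite (ltNge x c) (ltW xc) /= in ua.
  have [d d0 hd] := usc_ball (fuzzy_usc (f := u)) ua.
  have cd : Num.max c (x - d / 2) < x by rewrite gt_max xc; lra.
  have dd : x - d / 2 <= Num.max c (x - d / 2) by rewrite le_max lexx orbT.
  exists (Num.max c (x - d / 2)) => //.
  rewrite right_partE -/c (ltNge (Num.max _ _) c) le_max lexx /=; apply: hd.
  by rewrite ger0_norm; lra.
- rewrite left_partE -/c; have -> : x <= c by lra.
  by apply: out; rewrite in_itv /= leNgt xM.
- rewrite left_partE -/c; case: leP => // xc; have -> : x = c by lra.
  exact: u_c.
- rewrite right_partE -/c; case: ltP => // xc; have -> : x = c by lra.
  exact: u_c.
- rewrite right_partE -/c; have -> : (x < c) = false by apply/negP; lra.
  by apply: out; rewrite in_itv /= andbC leNgt xM.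
- by rewrite left_part_lt1 right_partE => ->.
Qed.

End ToProfile.

End Profiles.

Arguments profile {R} M L Rt.

Lemma left_part01 {R : realType} {M : R} (u : fuzzy_on M) (x : R) : I01 (left_part u x).
Proof. exact: (profile_l01 (profile_of_fuzzy (u := u))). Qed.

Lemma right_part01 {R : realType} {M : R} (u : fuzzy_on M) (x : R) : I01 (right_part u x).
Proof. exact: (profile_r01 (profile_of_fuzzy (u := u))). Qed.

#[local] Hint Resolve left_part01 right_part01 : core.

(** * Directed bases of enriched categories *)

Lemma T_sup {R : realType} {T : R -> R -> R} (hT : continuous_tnorm T)
    (A : set R) (a c : R) :
  A `<=` I01 -> A !=set0 -> I01 a -> 0 <= c ->
  (forall x, A x -> T a x <= c) -> T a (sup A) <= c.
Proof.
move=> A01 A0 ha c0 h; apply: (T_le_lim hT) => //; first exact: sup01.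
move=> b hb /(sup01_gt A01 A0)[x Ax bx]; apply: le_trans (h x Ax).
by apply: T_le => //; [apply: A01 | apply: ltW].
Qed.

Section NetWeights.
Context {R : realType} {X : Type} {hom : X -> X -> R}.
Hypothesis hom01 : forall x y, I01 (hom x y).
Context {D : Type} {le : D -> D -> Prop} {x : D -> X}.
Hypothesis dir : directed le.

Let tail z i := [set hom z (x j) | j in le i].

Let tail01 z i : tail z i `<=` I01.
Proof. by move=> _ [j _ <-]. Qed.

Let tail0 z i : tail z i !=set0.
Proof. by exists (hom z (x i)), i => //; apply: directed_refl. Qed.

Let tail_inf01 z : unit_valued (fun i => inf (tail z i)).
Proof. by move=> i; apply: inf01. Qed.

Lemma net_weight01 : unit_valued (net_weight hom le x).
Proof. by move=> z; have [i] := directed_inh dir; apply: (sup_range01 (tail_inf01 z) i). Qed.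

Lemma net_weight_ge i z b : (forall j, le i j -> b <= hom z (x j)) ->
  b <= net_weight hom le x z.
Proof.
move=> h; apply: le_trans (sup_range_ge (tail_inf01 z) i).
by apply/(inf01P (@tail01 z i) (tail0 z i)) => _ [j ij <-]; apply: h.
Qed.

(** Together with [net_weight_ge], this replaces the sup-inf formula by eventual
    statements about the net. *)
Lemma net_weight_gt z b : b < net_weight hom le x z ->
  exists i, forall j, le i j -> b <= hom z (x j).
Proof.
have [i0] := directed_inh dir.
move=> /(sup_range_gt (tail_inf01 z) i0)[i lt_b]; exists i => j ij.
apply: le_trans (ltW lt_b) _; apply: (inf01_le (@tail01 z i) (tail0 z i)).
by exists j.
Qed.

Lemma forward_Cauchy_gt s : forward_Cauchy hom le x -> s < 1 ->
  exists i, forall j k, le i j -> le j k -> s <= hom (x j) (x k).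
Proof.
rewrite /forward_Cauchy => fc; rewrite -fc.
set tails := fun i => inf _; have [i0] := directed_inh dir.
have sub i : [set hom (x jk.1) (x jk.2) | jk in
    [set jk | le i jk.1 /\ le jk.1 jk.2]] `<=` I01 by move=> _ [jk _ <-].
have ne i : [set hom (x jk.1) (x jk.2) | jk in
    [set jk | le i jk.1 /\ le jk.1 jk.2]] !=set0.
  by exists (hom (x i) (x i)), (i, i) => //=; split; apply: directed_refl.
have tails01 : unit_valued tails by move=> i; apply: inf01.
move=> /(sup_range_gt tails01 i0)[i lt_s]; exists i => j k ij jk.
apply: le_trans (ltW lt_s) _; apply: (inf01_le (sub i) (ne i)).
by exists (j, k).
Qed.

End NetWeights.

Section EnrichedCategories.
Context {R : realType} {T : R -> R -> R}.
Hypothesis hT : continuous_tnorm T.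
Context {X : Type} {hom : X -> X -> R}.
Hypothesis enc : is_encat T hom.

Let hom01 x y : I01 (hom x y).
Proof. by case: enc. Qed.

Let homxx x : hom x x = 1.
Proof. by case: enc. Qed.

Let homT x y z : T (hom y z) (hom x y) <= hom x z.
Proof. by case: enc. Qed.

Lemma hom1_le_r x y z : hom x y = 1 -> hom z x <= hom z y.
Proof. by move=> xy; have := homT z x y; rewrite xy (T1x hT). Qed.

Lemma hom1_le_l x y z : hom x y = 1 -> hom y z <= hom x z.
Proof. by move=> xy; have := homT x y z; rewrite xy (Tx1 hT). Qed.

Lemma colimitP (phi : X -> R) (c : X) : unit_valued phi ->
  is_colimit T hom phi c <->
  forall x b, I01 b -> (b <= hom c x <-> forall y, T (phi y) b <= hom y x).
Proof.
move=> phi01.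
have r01 x : unit_valued (fun y => res T (phi y) (hom y x)).
  by move=> y; apply: res01.
have key x b : I01 b -> b <= inf (range (fun y => res T (phi y) (hom y x))) <->
    forall y, T (phi y) b <= hom y x.
  move=> hb; rewrite (inf_rangeP (r01 x) c).
  by split=> h y; have := h y; rewrite (resP hT).
split=> [lim_c x b hb|h x]; first by rewrite lim_c key.
apply: eq_by_le01 => // [|b hb]; first exact: (inf_range01 (r01 x) c).
by rewrite h // key.
Qed.

Lemma weightP (phi : X -> R) :
  is_weight T hom phi <->
  unit_valued phi /\ forall x y, T (phi x) (hom y x) <= phi y.
Proof.
by split=> -[phi01 h]; split=> // x y; have := h x y; rewrite (resP hT).
Qed.

Lemma colimit_ub (phi : X -> R) c y : unit_valued phi ->
  is_colimit T hom phi c -> phi y <= hom y c.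
Proof.
move=> phi01 /(colimitP c phi01)/(_ c 1 (@I01_1 R))[+ _].
by rewrite homxx => /(_ (lexx _) y); rewrite (Tx1 hT).
Qed.

Lemma ideal_homP (phi psi : fc_ideal T hom) (x0 : X) b : I01 b ->
  b <= ideal_hom phi psi <-> forall x, T (phi x) b <= psi x.
Proof.
move=> hb; have [[phi01 _] _] := fc_idealP phi; have [[psi01 _] _] := fc_idealP psi.
have r01 : unit_valued (fun x => res T (phi x) (psi x)) by move=> x; apply: res01.
rewrite /ideal_hom (inf_rangeP r01 x0).
by split=> h x; have := h x; rewrite (resP hT).
Qed.

Lemma ideal_hom01 (phi psi : fc_ideal T hom) (x0 : X) : I01 (ideal_hom phi psi).
Proof.
have [[phi01 _] _] := fc_idealP phi; have [[psi01 _] _] := fc_idealP psi.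
by apply: inf_range01 => // x; apply: res01.
Qed.

Section DirectedSets.
Context {A : set X}.
Hypotheses (A0 : A !=set0)
  (Adir : forall x y, A x -> A y ->
    exists z, [/\ A z, hom x z = 1 & hom y z = 1]).

(** The union of the representable weights X(-, w) for w in A. *)
Definition lower_weight v := sup [set hom v w | w in A].

Let img01 v : [set hom v w | w in A] `<=` I01.
Proof. by move=> _ [w _ <-]. Qed.

Let img0 v : [set hom v w | w in A] !=set0.
Proof. by have [w Aw] := A0; exists (hom v w), w. Qed.

Lemma lower_weight01 : unit_valued lower_weight.
Proof. by move=> v; apply: sup01. Qed.

Lemma lower_weight_ge v w : A w -> hom v w <= lower_weight v.
Proof. by move=> Aw; apply: (sup01_ge (@img01 v) (img0 v)); exists w. Qed.

Lemma T_lower_weight_le a v c : I01 a -> 0 <= c ->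
  (forall w, A w -> T a (hom v w) <= c) -> T a (lower_weight v) <= c.
Proof.
move=> ha c0 h; apply: T_sup => //.
by move=> _ [w Aw <-]; apply: h.
Qed.

Let idx := {w : X | A w}.
Let le (i j : idx) := hom (sval i) (sval j) = 1.

Let le_dir : directed le.
Proof.
split=> [|i|i j k ij jk|[x Ax] [y Ay]].
- by have [w Aw] := A0; split; exists w.
- exact: homxx.
- apply/eqP; rewrite eq_le (I01_le1 (hom01 _ _)) /= -[leLHS]ij.
  exact: hom1_le_r.
- by have [z [Az xz yz]] := Adir Ax Ay; exists (exist _ z Az).
Qed.

Let le_fc : forward_Cauchy hom le sval.
Proof.
have one i : inf [set hom (sval jk.1) (sval jk.2) | jk in
    [set jk : idx * idx | le i jk.1 /\ le jk.1 jk.2]] = 1.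
  rewrite (_ : [set _ | _ in _] = [set 1]) ?inf1 // eqEsubset; split.
    by move=> _ [[j k] /= [_ jk] <-].
  by move=> _ ->; exists (i, i) => //=; split; apply: (directed_refl le_dir).
rewrite /forward_Cauchy (_ : [set _ | _ in setT] = [set 1]) ?sup1 // eqEsubset; split.
  by move=> _ [i _ <-]; apply: one.
by move=> _ ->; have [i] := directed_inh le_dir; exists i.
Qed.

Let le_weight : lower_weight = net_weight hom le sval.
Proof.
apply/funext => v; rewrite /lower_weight /net_weight; congr sup.
have tail_inf (i : idx) : inf [set hom v (sval j) | j in le i] = hom v (sval i).
  have sub : [set hom v (sval j) | j in le i] `<=` I01 by move=> _ [j _ <-].
  have vi : [set hom v (sval j) | j in le i] (hom v (sval i)).
    by exists i => //; apply: (directed_refl le_dir).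
  have ne : [set hom v (sval j) | j in le i] !=set0 by exists (hom v (sval i)).
  apply/eqP; rewrite eq_le inf01_le //=.
  by apply/(inf01P sub ne) => _ [j ij <-]; apply: hom1_le_r.
rewrite eqEsubset; split=> [_ [w Aw <-]|_ [[w Aw] _ <-]].
  by exists (exist _ w Aw) => //; rewrite tail_inf.
by rewrite tail_inf; exists w.
Qed.

(** The directed set, indexed by itself, is an increasing net, hence forward
    Cauchy, and the tail infima of the net weight are attained at the start. *)
Lemma lower_weight_ideal : is_fc_ideal T hom lower_weight.
Proof.
split; last by exists idx, le, sval.
apply/weightP; split=> [|x y]; first exact: lower_weight01.
rewrite (TC hT) //; last exact: lower_weight01.
apply: T_lower_weight_le => // [|w Aw]; first exact: I01_ge0 (lower_weight01 y).
by rewrite (TC hT) //; apply: le_trans (homT _ _ _) (lower_weight_ge _ Aw).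
Qed.

Definition lower_ideal := FcIdeal lower_weight_ideal.

(** An enriched Yoneda lemma, applied to each generator of the ideal. *)
Lemma lower_ideal_homP (psi : fc_ideal T hom) b : I01 b ->
  b <= ideal_hom lower_ideal psi <-> forall w, A w -> b <= psi w.
Proof.
move=> hb; have [x0 _] := A0; have [/weightP[psi01 psiT] _] := fc_idealP psi.
rewrite (ideal_homP _ _ x0) //; split=> [h w Aw|h v] /=.
  have := h w; suff -> : lower_ideal w = 1 by rewrite (T1x hT).
  apply/eqP; rewrite eq_le (I01_le1 (lower_weight01 w)) /=.
  by rewrite -(homxx w); apply: lower_weight_ge.
rewrite (TC hT) //; last exact: lower_weight01.
apply: T_lower_weight_le => // [|w Aw]; first exact: I01_ge0.
by apply: le_trans (psiT w v); apply: (T_le hT) => //; apply: h.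
Qed.

End DirectedSets.

(** The ideal t(u) generated by A(u) satisfies I(t(u), psi) = X(u, colim psi).
    Functoriality of t is a consequence, since u is below colim t(u).  The way
    below weight of u is at most t(u), as one sees by taking psi = t(u), and at
    least t(u) by the adjunction. *)
Lemma domain_of_directed_bases (A : X -> set X) :
  yoneda_complete T hom ->
  (forall u, A u !=set0) ->
  (forall u x y, A u x -> A u y ->
    exists z, [/\ A u z, hom x z = 1 & hom y z = 1]) ->
  (forall u (psi : fc_ideal T hom) c b, is_colimit T hom psi c -> I01 b ->
    (b <= hom u c <-> forall w, A u w -> b <= psi w)) ->
  exists D : enriched_domain T hom, forall u v,
    way_below (domain_complete D) v u = sup [set hom v w | w in A u].
Proof.
move=> Y A0 Adir Akey.
pose t u := lower_ideal (A0 u) (Adir u).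
have col_lim (psi : fc_ideal T hom) : is_colimit T hom psi (colim Y psi) by apply: (svalP (cid (Y psi))).
have adj u psi : ideal_hom (t u) psi = hom u (colim Y psi).
  apply: eq_by_le01 => // [|b hb]; first exact: ideal_hom01.
  by rewrite lower_ideal_homP // (Akey u psi (colim Y psi)).
have ideal_xx (phi : fc_ideal T hom) (x0 : X) : 1 <= ideal_hom phi phi.
  have [[phi01 _] _] := fc_idealP phi.
  by rewrite (ideal_homP _ _ x0); [move=> x; rewrite (Tx1 hT)|exact: I01_1].
have ut u : hom u (colim Y (t u)) = 1.
  by apply/eqP; rewrite eq_le (I01_le1 (hom01 _ _)) /= -adj ideal_xx.
have t_functor : is_functor hom (@ideal_hom R T X hom) t.
  by move=> u v; rewrite adj; apply: hom1_le_r.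
have colim_functor : is_functor (@ideal_hom R T X hom) hom (colim Y).
  move=> phi psi; have [[phi01 _] _] := fc_idealP phi.
  have [[psi01 _] _] := fc_idealP psi.
  have i01 := ideal_hom01 phi psi (colim Y phi).
  apply/((colimitP _ phi01).1 (col_lim phi)) => // y.
  apply: le_trans (colimit_ub y psi01 (col_lim psi)).
  exact: (ideal_homP phi psi (colim Y phi) i01).1 (lexx _) y.
have cont : continuous_encat Y by exists t; split.
exists (EnrichedDomain enc cont) => u v; rewrite /=.
have wb01 : unit_valued (fun phi : fc_ideal T hom => res T (hom u (colim Y phi)) (phi v)).
  by move=> phi; have [[phi01 _] _] := fc_idealP phi; apply: res01.
apply/eqP; rewrite eq_le; apply/andP; split.
  apply: le_trans (inf_range_le wb01 (t u)) _.
  by rewrite ut (res1x hT) //; apply: lower_weight01.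
have tv01 := lower_weight01 (A0 u) v.
apply/(inf_rangeP wb01 (t u)) => phi; have [[phi01 _] _] := fc_idealP phi.
rewrite (resP hT) // (TC hT) // -adj.
have i01 := ideal_hom01 (t u) phi u.
by have := (ideal_homP (t u) phi u i01).1 (lexx _) v.
Qed.

End EnrichedCategories.

(** * Continuity points of monotone functions *)

Section ContinuityPoints.
Context {R : realType}.
Implicit Types (f : R -> R) (a b x : R).

(** One-sided limits exist and enclose the value, so they can only fail to
    agree. *)
Lemma nondecreasing_continuous_or_jump f x : {homo f : y z / y <= z} ->
  {for x, continuous f} \/ discontinuity f x.
Proof.
move=> fmono.
have cl : cvg (f y @[y --> x^'-]).
  apply: nondecreasing_at_left_is_cvgr.
    by near=> r => y z _ _; apply: fmono.
  by near=> r; exists (f x) => _ /= [z zr <-]; apply: fmono; move: zr; rewrite in_itv /= => /andP[_ /ltW].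
have cr : cvg (f y @[y --> x^'+]).
  apply: nondecreasing_at_right_is_cvgr.
    by near=> r => y z _ _; apply: fmono.
  by near=> r; exists (f x) => _ /= [z zr <-]; apply: fmono; move: zr; rewrite in_itv /= => /andP[/ltW].
have [lr|lr] := eqVneq (lim (f y @[y --> x^'-])) (lim (f y @[y --> x^'+])); last by right.
left; have l_le : lim (f y @[y --> x^'-]) <= f x.
  apply: limr_le => //; near=> y; apply: fmono; near: y; exact: nbhs_left_le.
have r_ge : f x <= lim (f y @[y --> x^'+]).
  apply: limr_ge => //; near=> y; apply: fmono; near: y; exact: nbhs_right_ge.
have fl : lim (f y @[y --> x^'-]) = f x by lra.
have fr : lim (f y @[y --> x^'+]) = f x by lra.
by apply/left_right_continuousP; split; [rewrite -fl|rewrite -fr].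
Unshelve. all: end_near. Qed.

(** Jumps are countable, an interval of positive length is not. *)
Lemma nondecreasing_continuity_point f a b : {homo f : y z / y <= z} -> a < b ->
  exists2 x, a < x < b & {for x, continuous f}.
Proof.
move=> fmono ab; apply: contrapT => none.
have cnt : countable `]a, b[%classic.
  apply: sub_countable (@discontinuity_countable R a b f _); last first.
    by move=> y z _ _; apply: fmono.
  apply: subset_card_le => x /= xab; split=> //.
  have [cx|//] := @nondecreasing_continuous_or_jump f x fmono.
  by case: none; exists x => //; move: xab; rewrite in_itv.
have := countable_lebesgue_measure0 cnt.
rewrite lebesgue_measure_itv /= lte_fin ab => /eqP.
by rewrite -EFinB eqe subr_eq0 gt_eqF.
Qed.

Lemma nonincreasing_continuity_point f a b : {homo f : y z / y <= z >-> z <= y} -> a < b ->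
  exists2 x, a < x < b & {for x, continuous f}.
Proof.
move=> fmono ab.
have [|x xab cx] := @nondecreasing_continuity_point (fun y => - f y) a b _ ab.
  by move=> y z yz; rewrite lerN2; apply: fmono.
exists x => //; rewrite (_ : f = fun y => - - f y); first exact: continuousN.
by apply/funext => y; rewrite opprK.
Qed.

Lemma continuous_gt_right f x a : {for x, continuous f} -> a < f x ->
  exists2 y, x < y & a < f y.
Proof.
move=> /cvgrPdist_lt/(_ (f x - a)) h afx; move: h; rewrite subr_gt0 => /(_ afx).
move=> /nbhs_ballP[d /= d0 hd]; exists (x + d / 2); first lra.
have /hd /= : ball x d (x + d / 2) by rewrite /ball /= ler0_norm; lra.
by rewrite ltr_norml => /andP[]; lra.
Qed.

End ContinuityPoints.

(** * The enriched category of fuzzy numbers *)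

Section FuzzyHom.
Context {R : realType} {T : R -> R -> R} {M : R}.
Hypothesis hT : continuous_tnorm T.
Implicit Types (u v w z c : fuzzy_on M) (x y t s a b : R).

Let sections01 u v : unit_valued (fun x =>
  Order.min (res T (left_part v x) (left_part u x))
            (res T (right_part u x) (right_part v x))).
Proof.
by move=> x; case: leP => _;
  [apply: (res01 hT (left_part01 v x) (left_part01 u x))|apply: (res01 hT (right_part01 u x) (right_part01 v x))].
Qed.

Lemma PM01 u v : I01 (PM T u v).
Proof. exact: (inf_range01 (sections01 u v) 0). Qed.

(** P is an infimum of residuals, so residuation turns a lower bound of P into
    pointwise inequalities. *)
Lemma PMP b u v : I01 b -> b <= PM T u v <->
  forall x, T b (left_part v x) <= left_part u x /\
            T b (right_part u x) <= right_part v x.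
Proof.
move=> hb; rewrite /PM /P_hom (inf_rangeP (sections01 u v) 0).
have res_iff (y y' : R) : I01 y -> I01 y' -> b <= res T y y' <-> T b y <= y'.
  by move=> hy hy'; rewrite resP // (TC hT).
split=> h x; have := h x; rewrite le_min.
  case/andP=> hl hr; split.
    exact: (res_iff _ _ (left_part01 v x) (left_part01 u x)).1.
  exact: (res_iff _ _ (right_part01 u x) (right_part01 v x)).1.
move=> [hl hr]; apply/andP; split.
  exact: (res_iff _ _ (left_part01 v x) (left_part01 u x)).2.
exact: (res_iff _ _ (right_part01 u x) (right_part01 v x)).2.
Qed.

Lemma PM_eq1 u v : PM T u v = 1 <->
  forall x, left_part v x <= left_part u x /\ right_part u x <= right_part v x.
Proof.
split=> [uv x|h].
  have [h _] := PMP u v (@I01_1 R); have [|h1 h2] := h _ x; first by rewrite uv.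
  by rewrite !(T1x hT) in h1 h2.
apply/eqP; rewrite eq_le (I01_le1 (PM01 _ _)) /=.
by apply/(PMP _ _ (@I01_1 R)) => x; rewrite !(T1x hT).
Qed.

Lemma PM_encat : is_encat T (@PM R T M).
Proof.
split=> [u v|u|u v w]; first exact: PM01.
  by apply/PM_eq1.
have h1 := PM01 u v; have h2 := PM01 v w.
have [/(_ (lexx _)) uv _] := PMP u v h1; have [/(_ (lexx _)) vw _] := PMP v w h2.
apply/PMP => [|x]; first exact: T01.
have [uvl uvr] := uv x; have [vwl vwr] := vw x; split.
  rewrite (TC hT h2 h1) -(TA hT) //.
  by apply: le_trans uvl; apply: (T_le hT) => //; apply: T01.
rewrite -(TA hT) //; apply: le_trans vwr; apply: (T_le hT) => //; exact: T01.
Qed.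

(** The join of the underlying order is also an enriched coproduct, because &
    is monotone and the order of the values is total. *)
Lemma fuzzy_join u v : exists w, forall z b, I01 b ->
  b <= PM T w z <-> b <= PM T u z /\ b <= PM T v z.
Proof.
have [|w [wl wr]] := @fuzzy_of_profile R M
  (fun x => Num.min (left_part u x) (left_part v x))
  (fun x => Num.max (right_part u x) (right_part v x)).
  split=> [x|x|x y xy|x y xy|x a|x a|x xM|x xM|x xM|x xM|x].
  - by case: leP.
  - by case: leP.
  - by rewrite le_min !ge_min !(profile_l_le profile_of_fuzzy xy) orbT.
  - by rewrite ge_max !le_max !(profile_r_le profile_of_fuzzy xy) orbT.
  - rewrite gt_min => /orP[] /(profile_l_usc profile_of_fuzzy)[y xy ya]; exists y => //;
    by rewrite gt_min ya ?orbT.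
  - rewrite gt_max => /andP[/(profile_r_usc profile_of_fuzzy)[y yx ya] /(profile_r_usc profile_of_fuzzy)[y' yx' ya']].
    exists (Num.max y y'); first by rewrite gt_max yx.
    rewrite gt_max; apply/andP; split.
      by apply: le_lt_trans ya; apply: (profile_r_le profile_of_fuzzy); rewrite le_max lexx.
    by apply: le_lt_trans ya'; apply: (profile_r_le profile_of_fuzzy); rewrite le_max lexx orbT.
  - by rewrite !(profile_l0 profile_of_fuzzy) // minxx.
  - by rewrite !(profile_l1 profile_of_fuzzy) // minxx.
  - by rewrite !(profile_r1 profile_of_fuzzy) // maxxx.
  - by rewrite !(profile_r0 profile_of_fuzzy) // maxxx.
  - rewrite gt_min => /orP[] /(profile_lr profile_of_fuzzy) ->.
      by rewrite max_l // I01_le1.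
    by rewrite max_r // I01_le1.
exists w => z b hb; rewrite !(PMP _ _ hb) wl wr; split=> [h|[h1 h2] x].
  split=> x; have := h x; rewrite le_min => -[/andP[hl1 hl2] hr]; split=> //;
  by apply: le_trans hr; apply: (T_le hT) => //; rewrite ?le_max ?lexx ?orbT //; case: leP.
have [hl1 hr1] := h1 x; have [hl2 hr2] := h2 x.
by split; [rewrite le_min hl1|case: (leP (right_part u x))].
Qed.

(** The witness is the characteristic function of {-M}. *)
Lemma fuzzy_bottom : 0 < M -> exists w, forall z, PM T w z = 1.
Proof.
move=> M0.
have [|w [wl wr]] := @fuzzy_of_profile R M
  (fun x => if x < - M then 0 else 1) (fun x => if x <= - M then 1 else 0).
  split=> [x|x|x y xy|x y xy|x a|x a|x xM|x xM|x xM|x xM|x].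
  - by case: ltP => _; [apply: I01_0|apply: I01_1].
  - by case: leP => _; [apply: I01_1|apply: I01_0].
  - by case: (ltP x); case: (ltP y) => //; lra.
  - by case: (leP x); case: (leP y) => //; lra.
  - case: (ltP x) => xM /= xa.
      exists ((x - M) / 2); first lra.
      by have -> : (x - M) / 2 < - M by lra.
    by exists (x + 1); [lra|case: (ltP (x + 1)); lra].
  - case: (leP x) => xM /= xa.
      by exists (x - 1); [lra|case: (leP (x - 1)); lra].
    exists ((x - M) / 2); first lra.
    by have -> : ((x - M) / 2 <= - M) = false by apply/negP; lra.
  - by rewrite xM.
  - by rewrite ifF //; apply/negP; lra.
  - by rewrite xM.
  - by rewrite ifF //; apply/negP; lra.
  - by case: (ltP x) => // xM; rewrite ?ltxx // ifT // ltW.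
exists w => z; apply/PM_eq1 => x; rewrite wl wr; split.
  by case: (ltP x) => xM; [rewrite (profile_l0 (profile_of_fuzzy (u := z)))|apply: I01_le1].
by case: (leP x) => xM; [rewrite (profile_r1 (profile_of_fuzzy (u := z)))|apply: I01_ge0].
Qed.

End FuzzyHom.

(** * Colimits of forward Cauchy nets of fuzzy numbers *)

Section NetColimit.
Context {R : realType} {T : R -> R -> R} {M : R}.
Hypothesis hT : continuous_tnorm T.
Context {D : Type} {le : D -> D -> Prop} {n : D -> fuzzy_on M}.
Hypotheses (dir : directed le) (n_fc : forward_Cauchy (@PM R T M) le n).
Implicit Types (u v w z c : fuzzy_on M) (x y t s a b : R).

(** The infimum of above t is the right limit at t of the limsup of the left parts. *)
Let above t := [set y | I01 y /\ exists s i, t < s /\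
  forall j, le i j -> left_part (n j) s <= y].

(** The supremum of below t is the left limit at t of the liminf of the right parts. *)
Let below t := [set y | I01 y /\ forall s, s < t ->
  exists i, forall j, le i j -> y <= right_part (n j) s].

Let above01 t : above t `<=` I01.
Proof. by move=> y []. Qed.

Let below01 t : below t `<=` I01.
Proof. by move=> y []. Qed.

Let above1 t : above t !=set0.
Proof.
have [i] := directed_inh dir; exists 1; split; first exact: I01_1.
by exists (t + 1), i; split=> [|j _]; [lra|apply: I01_le1].
Qed.

Let below0 t : below t !=set0.
Proof.
have [i] := directed_inh dir; exists 0; split; first exact: I01_0.
by move=> s _; exists i => j _; apply: I01_ge0.
Qed.

Let above_inf t y : above t y -> inf (above t) <= y.
Proof. exact: inf01_le. Qed.

Let below_sup t y : below t y -> y <= sup (below t).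
Proof. exact: sup01_ge. Qed.

(** The coupling of left and right parts passes to the limit: if the left limit
    is below 1 at t, the right parts are eventually 1 at a point beyond t. *)
Let net_limit : exists c,
  left_part c = (fun t => inf (above t)) /\
  right_part c = (fun t => sup (below t)).
Proof.
apply: fuzzy_of_profile; split=> [t|t|t t' tt|t t' tt|t a|t a|t tM|t tM|t tM|t tM|t].
- exact: inf01.
- exact: sup01.
- apply/(inf01P (@above01 _) (above1 _)) => y [hy [s [i [ts le_y]]]].
  by apply: above_inf; split=> //; exists s, i; split=> //; apply: le_lt_trans ts.
- apply/(sup01P (@below01 _) (below0 _)) => y [hy le_y].
  by apply: below_sup; split=> // s st; apply: le_y; apply: lt_le_trans tt.
- move=> /(inf01_lt (@above01 _) (above1 _))[y [hy [s [i [ts le_y]]]] ya].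
  exists ((t + s) / 2); first lra.
  by apply: le_lt_trans ya; apply: above_inf; split=> //; exists s, i; split=> //; lra.
- move=> lt_a; apply: contrapT => none.
  have ge_a t' : t' < t -> a <= sup (below t').
    by move=> t't; rewrite leNgt; apply/negP => h; apply: none; exists t'.
  have a1 : a <= 1.
    by apply: le_trans (ge_a (t - 1) ltac:(lra)) (I01_le1 (sup01 (@below01 _) (below0 _))).
  have s0 := I01_ge0 (sup01 (@below01 t) (below0 t)).
  (* a value strictly between sup (below t) and a would also belong to below t *)
  suff : (sup (below t) + a) / 2 <= sup (below t) by lra.
  apply: below_sup; split=> [|s st]; first by apply: I01_mk; lra.
  have lt_mid : (sup (below t) + a) / 2 < sup (below ((s + t) / 2)).
    by have := ge_a ((s + t) / 2) ltac:(lra); lra.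
  have [y [hy le_y] lt_y] := sup01_gt (@below01 _) (below0 _) lt_mid.
  have [i hi] := le_y s ltac:(lra).
  by exists i => j /hi; lra.
- apply/eqP; rewrite eq_le (I01_ge0 (inf01 (@above01 _) (above1 _))) andbT.
  have [i] := directed_inh dir; apply: above_inf; split; first exact: I01_0.
  exists ((t - M) / 2), i; split=> [|j _]; first lra.
  by rewrite (profile_l0 profile_of_fuzzy) //; lra.
- apply/eqP; rewrite eq_le (I01_le1 (inf01 (@above01 _) (above1 _))) /=.
  apply/(inf01P (@above01 _) (above1 _)) => y [hy [s [i [ts le_y]]]].
  have := le_y i (directed_refl dir i); rewrite (profile_l1 profile_of_fuzzy) //; lra.
- apply/eqP; rewrite eq_le (I01_le1 (sup01 (@below01 _) (below0 _))) /=.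
  apply: below_sup; split=> [|s st]; first exact: I01_1.
  have [i] := directed_inh dir; exists i => j _.
  by rewrite (profile_r1 profile_of_fuzzy) //; lra.
- apply/eqP; rewrite eq_le (I01_ge0 (sup01 (@below01 _) (below0 _))) andbT.
  apply/(sup01P (@below01 _) (below0 _)) => y [hy le_y].
  have [i hi] := le_y ((M + t) / 2) ltac:(lra).
  by have := hi i (directed_refl dir i); rewrite (profile_r0 profile_of_fuzzy) //; lra.
- move=> /(inf01_lt (@above01 _) (above1 _))[y [hy [s [i [ts le_y]]]] y1].
  apply/eqP; rewrite eq_le (I01_le1 (sup01 (@below01 _) (below0 _))) /=.
  apply: below_sup; split=> [|s' st]; first exact: I01_1.
  exists i => j /le_y ly.
  have <- : right_part (n j) s = 1 by apply: (profile_lr profile_of_fuzzy); lra.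
  by apply: (profile_r_le profile_of_fuzzy); lra.
Qed.

Let hom01 (u v : fuzzy_on M) : I01 (PM T u v).
Proof. exact: PM01. Qed.

Let phi := net_weight (@PM R T M) le n.

Let phi01 : unit_valued phi := net_weight01 hom01 dir.

(** The regularisations are harmless for the universal property, since the
    parts of the target are semicontinuous as well.  The Cauchy condition enters
    only to show that an upper bound b of the weight bounds the colimit: b is
    first weakened to b & s with s < 1, and then P(n_j, z) is bounded below
    for all large j. *)
Lemma net_colimit : exists c, [/\ is_colimit T (@PM R T M) phi c,
  forall t y, left_part c t < y ->
    exists i, forall j, le i j -> left_part (n j) t < y &
  forall t t' y, t < t' -> y < right_part c t' ->
    exists i, forall j, le i j -> y < right_part (n j) t].
Proof.
have [c [cl cr]] := net_limit; exists c; split; last 2 first.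
- rewrite cl => t y /(inf01_lt (@above01 _) (above1 _))[y' [hy' [s [i [ts le_y]]]] yy].
  exists i => j /le_y h; apply: le_lt_trans yy; apply: le_trans h.
  by apply: (profile_l_le profile_of_fuzzy); apply: ltW.
- rewrite cr => t t' y tt /(sup01_gt (@below01 _) (below0 _))[y' [hy' le_y] yy].
  by have [i hi] := le_y t tt; exists i => j /hi; apply: lt_le_trans.
have phi_c u : phi u <= PM T u c.
  apply: le_by_lt01 => //; first exact: I01_ge0.
  move=> m hm /(net_weight_gt hom01 dir)[i hi].
  apply/(PMP hT) => // t; rewrite cl cr; split.
    apply: ge_by_gt => a /(profile_l_usc (profile_of_fuzzy (u := u)))[t' tt' lt_a].
    apply: le_trans (ltW lt_a).
    have hr := res01 hT hm (left_part01 u t').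
    apply/(resP hT) => //; first exact: inf01.
    apply: above_inf; split=> //; exists t', i; split=> // j ij.
    apply/(resP hT) => //.
    have [/(_ (hi j ij)) h _] := PMP hT u (n j) hm.
    by have [] := h t'.
  apply: below_sup; split=> [|s st]; first exact: T01.
  exists i => j ij.
  have [/(_ (hi j ij)) h _] := PMP hT u (n j) hm.
  have [_] := h s; apply: le_trans; apply: (T_le hT) => //.
  by apply: (profile_r_le profile_of_fuzzy); apply: ltW.
apply/(colimitP hT (PM_encat hT)) => // z b hb; split=> [bc u|h].
  rewrite (TC hT) //; have [_ _ /(_ u c z)] := PM_encat (M := M) hT.
  by apply: le_trans; apply: (T_le hT).
rewrite -(Tx1 hT hb); apply: (T_le_lim hT) => //; [exact: I01_1|exact: I01_ge0|].
move=> s hs s1; have [i hi] := forward_Cauchy_gt hom01 dir n_fc s1.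
have hbs := T01 hT hb hs.
have tail j : le i j -> forall t,
    T (T b s) (left_part z t) <= left_part (n j) t /\
    T (T b s) (right_part (n j) t) <= right_part z t.
  move=> ij; apply/(PMP hT) => //; apply: le_trans (h (n j)).
  rewrite (TC hT) //; apply: (T_le hT) => //.
  apply: (net_weight_ge hom01 dir (i := j)) => k jk.
  exact: hi.
apply/(PMP hT) => // t; rewrite cl cr; split.
  apply/(inf01P (@above01 _) (above1 _)) => y [hy [x [i' [tx le_y]]]].
  have [j [ij i'j]] := directed_ub dir i i'.
  apply: le_trans (le_y j i'j); have [+ _] := tail j ij t.
  move/le_trans; apply; apply: (profile_l_le profile_of_fuzzy); exact: ltW.
apply: ge_by_gt => a /(profile_r_usc (profile_of_fuzzy (u := z)))[t' tt' lt_a].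
apply: le_trans (ltW lt_a); apply: (T_sup hT) => //; first exact: I01_ge0.
move=> y [hy le_y]; have [i' hi'] := le_y t' tt'.
have [j [ij i'j]] := directed_ub dir i i'.
have [_] := tail j ij t'; apply: le_trans; apply: (T_le hT) => //.
exact: hi'.
Qed.

End NetColimit.

(** * The way below relation *)

Lemma directed_finite_ub (D : Type) (le : D -> D -> Prop) k (g : 'I_k -> D) :
  directed le -> exists d, forall i, le (g i) d.
Proof.
move=> dir; elim: k g => [|k IHk] g.
  by have [d] := directed_inh dir; exists d => -[].
have [d hd] := IHk (fun i => g (lift ord0 i)).
have [d' [g0 dd']] := directed_ub dir (g ord0) d.
exists d' => i; case: (unliftP ord0 i) => [j ->|->] //.
exact: (directed_trans dir) (hd j) dd'.
Qed.

Section WayBelow.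
Context {R : realType} {T : R -> R -> R} {M : R}.
Hypotheses (hT : continuous_tnorm T) (hS : S_condition T) (M_gt0 : 0 < M).
Implicit Types (u v w z c : fuzzy_on M) (x y t s a b p r : R).

Let hom01 u v : I01 (PM T u v).
Proof. exact: PM01. Qed.

Let enc := PM_encat (M := M) hT.

Let homxx u : PM T u u = 1.
Proof. by case: enc. Qed.

Lemma fuzzy_yoneda_complete : yoneda_complete T (@PM R T M).
Proof.
move=> phi; have [_ [D [le [n [dir fc ->]]]]] := fc_idealP phi.
by have [c [lim_c _ _]] := net_colimit hT dir fc; exists c.
Qed.

(** Two colimits of psi have the same homs, hence the same parts, so the bounds
    of [net_colimit] hold for any colimit. *)
Lemma ideal_approximation (psi : fc_ideal T (@PM R T M)) c :
  is_colimit T (@PM R T M) psi c ->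
  exists (D : Type) (le : D -> D -> Prop) (n : D -> fuzzy_on M),
    [/\ directed le, psi = net_weight (@PM R T M) le n :> (_ -> _),
    forall t y, left_part c t < y ->
      exists i, forall j, le i j -> left_part (n j) t < y &
    forall t t' y, t < t' -> y < right_part c t' ->
      exists i, forall j, le i j -> y < right_part (n j) t].
Proof.
have [[psi01 _] [D [le [n [dir fc psiE]]]]] := fc_idealP psi.
move=> lim_c; exists D, le, n.
have [c' [lim_c' Hl Hr]] := net_colimit hT dir fc; rewrite -psiE in lim_c'.
have eq_hom z : PM T c z = PM T c' z by rewrite lim_c lim_c'.
have /PM_eq1-/(_ hT) cc' : PM T c c' = 1 by rewrite eq_hom.
have /PM_eq1-/(_ hT) c'c : PM T c' c = 1 by rewrite -eq_hom.
have el : left_part c = left_part c'.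
  apply/funext => x; apply/eqP; rewrite eq_le.
  by have [-> _] := cc' x; have [-> _] := c'c x.
have er : right_part c = right_part c'.
  apply/funext => x; apply/eqP; rewrite eq_le.
  by have [_ ->] := cc' x; have [_ ->] := c'c x.
by split=> //; rewrite ?el ?er.
Qed.

Lemma right_part_lt_core u x : x < inf (core u) -> right_part u x = 1.
Proof. by rewrite right_partE => ->. Qed.

Lemma core_inf_le u : inf (core u) <= M.
Proof. by rewrite leNgt -left_part_lt1 (profile_l1 (profile_of_fuzzy (u := u))) ?ltxx. Qed.

(** By density it suffices to bound the tail of a net n of psi by b' < b.  As w
    is a step number, b' <= P(w, n_j) only involves the values of n_j at r2 and
    r1.  The value of the left part at r2 is controlled by b & c^l(r2) < p2, the
    value of the right part at r2 by the room between r2 and the core of u, and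
    the value of the right part at r1 by the strict monotonicity of &.  When the
    core of u starts at -M, only the last bound is nontrivial. *)
Lemma way_below_step u c w (psi : fc_ideal T (@PM R T M)) b :
  is_colimit T (@PM R T M) psi c -> I01 b -> b <= PM T u c ->
  D0 u w -> b <= psi w.
Proof.
move=> lim_c hb b_uc Dw; have [[psi01 _] _] := fc_idealP psi.
have [D [le [n [dir psiE Hl Hr]]]] := ideal_approximation lim_c.
have /(PMP hT _ _ hb) uc := b_uc.
apply: le_by_lt01 => //; first exact: I01_ge0.
move=> b' hb' bb'.
have [i0] := directed_inh dir.
have join2 (P Q : D -> Prop) : (exists i, forall j, le i j -> P j) ->
    (exists i, forall j, le i j -> Q j) ->
    exists i, forall j, le i j -> P j /\ Q j.
  move=> [i hi] [k hk]; have [l [il kl]] := directed_ub dir i k.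
  exists l => j lj; split; [apply: hi|apply: hk]; exact: (directed_trans dir) lj.
suff [i hi] : exists i, forall j, le i j -> b' <= PM T w (n j).
  by rewrite psiE; apply: (net_weight_ge hom01 dir (i := i)).
(* the jump height p1 < u^r(r1) leaves a point beyond r1 still above p1 *)
have right_tail p1 r1 : {for r1, continuous (right_part u)} ->
    0 < p1 < right_part u r1 ->
    exists i, forall j, le i j -> T b' p1 <= right_part (n j) r1.
  move=> cr /andP[p0 p1r]; have [r1' rr p1r'] := continuous_gt_right cr p1r.
  have hp : I01 p1 by apply: I01_mk; [exact: ltW|exact: le_trans (ltW p1r) (I01_le1 (right_part01 _ _))].
  case: (T_strict hT hS hb hb' (right_part01 u r1') hp bb' p1r') => [lt_T|->]; last first.
    by exists i0 => j _; apply: I01_ge0.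
  have [i hi] := Hr _ _ _ rr (lt_le_trans lt_T (uc r1').2).
  by exists i => j /hi/ltW.
have hom_step p1 r2 r1 j : right_part w = step_right r2 p1 r1 -> r2 <= r1 ->
    I01 p1 -> b' <= right_part (n j) r2 -> T b' p1 <= right_part (n j) r1 ->
    (forall t, T b' (left_part (n j) t) <= left_part w t) -> b' <= PM T w (n j).
  move=> wr r21 hp1 h2 h1 hl; apply/(PMP hT) => // t; split; first exact: hl.
  rewrite wr /step_right; case: (leP t r2) => t2.
    by rewrite (Tx1 hT) //; apply: le_trans h2 _; apply: (profile_r_le profile_of_fuzzy).
  case: (leP t r1) => t1; last by rewrite (Tx0 hT) //; apply: I01_ge0.
  by apply: le_trans h1 _; apply: (profile_r_le profile_of_fuzzy).
case: Dw => [[Mc [p1 [p2 [r1 [r2 [[r2M r1M] r21 [_ cr1] [/andP[p2l p2lt] p1r] [wl wr]]]]]]]|].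
- have r2c : r2 < inf (core u) by rewrite -left_part_lt1; lra.
  have hp2 : I01 p2 by apply: I01_mk; have := I01_ge0 (left_part01 u r2); lra.
  (* b & c^l(r2) <= u^l(r2) < p2, and this persists in a neighbourhood *)
  have left_tail : exists i, forall j, le i j -> T b (left_part (n j) r2) < p2.
    have [d cd hd] := T_lt_nbhs hT hb (left_part01 c r2) (le_lt_trans (uc r2).1 p2l).
    by have [i hi] := Hl _ _ cd; exists i => j /hi; apply: hd.
  (* u^r is 1 up to the core, hence also at a point strictly beyond r2 *)
  have core_tail : exists i, forall j, le i j -> b' <= right_part (n j) r2.
    have r2r : r2 < (r2 + inf (core u)) / 2 by lra.
    have [|i hi] := Hr _ _ b' r2r; last by exists i => j /hi/ltW.
    apply: lt_le_trans bb' _; have [_] := uc ((r2 + inf (core u)) / 2).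
    by rewrite right_part_lt_core ?(Tx1 hT) //; lra.
  have [i hi] := join2 _ _ left_tail (join2 _ _ core_tail (right_tail _ _ cr1 p1r)).
  exists i => j /hi[hl [h2 h1]]; move: p1r => /andP[p0 p1r].
  apply: (hom_step p1 r2 r1) => //; first exact: ltW.
    by apply: I01_mk; [exact: ltW|exact: le_trans (ltW p1r) (I01_le1 (right_part01 _ _))].
  move=> t; rewrite wl /step_left; case: (ltP t (- M)) => tM.
    by rewrite (profile_l0 profile_of_fuzzy) // (Tx0 hT).
  case: (ltP t r2) => t2; last exact: I01_le1 (T01 hT hb' (left_part01 _ _)).
  apply: le_trans (ltW hl); apply: (T_le hT) => //; first exact: ltW.
  by apply: (profile_l_le profile_of_fuzzy); apply: ltW.
- move=> [Mc [p1 [r1 [r1M cr1 p1r [wl wr]]]]].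
  have [i hi] := right_tail _ _ cr1 p1r.
  exists i => j /hi h1; move: p1r => /andP[p0 p1r].
  apply: (hom_step p1 (- M) r1) => //; first by case/andP: r1M.
  + by apply: I01_mk; [exact: ltW|exact: le_trans (ltW p1r) (I01_le1 (right_part01 _ _))].
  + by rewrite (profile_r1 profile_of_fuzzy) //; apply: I01_le1.
  + move=> t; rewrite wl /step_left; case: (ltP t (- M)) => tM.
      by rewrite (profile_l0 profile_of_fuzzy) // (Tx0 hT).
    by case: (ltP t (- M)) => // t2; apply: I01_le1 (T01 hT hb' (left_part01 _ _)).
Qed.

Lemma step_fuzzy p1 p2 r1 r2 : I01 p1 -> I01 p2 -> - M <= r2 -> r2 <= r1 -> r1 <= M ->
  exists w, left_part w = step_left M p2 r2 /\ right_part w = step_right r2 p1 r1.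
Proof.
move=> hp1 hp2 r2M r21 r1M.
have [p10 p11] := (I01_ge0 hp1, I01_le1 hp1).
have [p20 p21] := (I01_ge0 hp2, I01_le1 hp2).
have sl x : [\/ x < - M /\ step_left M p2 r2 x = 0,
    [/\ - M <= x, x < r2 & step_left M p2 r2 x = p2] |
    r2 <= x /\ step_left M p2 r2 x = 1].
  rewrite /step_left; case: (ltP x (- M)) => h1; first by constructor 1.
  by case: (ltP x r2) => h2; [constructor 2|constructor 3].
have sr x : [\/ x <= r2 /\ step_right r2 p1 r1 x = 1,
    [/\ r2 < x, x <= r1 & step_right r2 p1 r1 x = p1] |
    r1 < x /\ step_right r2 p1 r1 x = 0].
  rewrite /step_right; case: (leP x r2) => h1; first by constructor 1.
  by case: (leP x r1) => h2; [constructor 2|constructor 3].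
apply: fuzzy_of_profile; split=> [x|x|x y xy|x y xy|x a|x a|x xM|x xM|x xM|x xM|x].
- by case: (sl x) => [[_ ->]|[_ _ ->]|[_ ->]] //; [apply: I01_0|apply: I01_1].
- by case: (sr x) => [[_ ->]|[_ _ ->]|[_ ->]] //; [apply: I01_1|apply: I01_0].
- by case: (sl x) => [[? ->]|[? ? ->]|[? ->]]; case: (sl y) => [[? ->]|[? ? ->]|[? ->]]; lra.
- by case: (sr x) => [[? ->]|[? ? ->]|[? ->]]; case: (sr y) => [[? ->]|[? ? ->]|[? ->]]; lra.
- case: (sl x) => [[h1 ->]|[h1 h2 ->]|[h1 ->]] lt_a.
  + exists ((x - M) / 2); first lra.
    by case: (sl ((x - M) / 2)) => [[? ->]|[? ? ->]|[? ->]]; lra.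
  + exists ((x + r2) / 2); first lra.
    by case: (sl ((x + r2) / 2)) => [[? ->]|[? ? ->]|[? ->]]; lra.
  + exists (x + 1); first lra.
    by case: (sl (x + 1)) => [[? ->]|[? ? ->]|[? ->]]; lra.
- case: (sr x) => [[h1 ->]|[h1 h2 ->]|[h1 ->]] lt_a.
  + exists (x - 1); first lra.
    by case: (sr (x - 1)) => [[? ->]|[? ? ->]|[? ->]]; lra.
  + exists ((x + r2) / 2); first lra.
    by case: (sr ((x + r2) / 2)) => [[? ->]|[? ? ->]|[? ->]]; lra.
  + exists ((x + r1) / 2); first lra.
    by case: (sr ((x + r1) / 2)) => [[? ->]|[? ? ->]|[? ->]]; lra.
- by case: (sl x) => [[? ->]|[? ? ->]|[? ->]]; lra.
- by case: (sl x) => [[? ->]|[? ? ->]|[? ->]]; lra.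
- by case: (sr x) => [[? ->]|[? ? ->]|[? ->]]; lra.
- by case: (sr x) => [[? ->]|[? ? ->]|[? ->]]; lra.
- by case: (sl x) => [[? ->]|[? ? ->]|[? ->]]; case: (sr x) => [[? ->]|[? ? ->]|[? ->]]; lra.
Qed.

Lemma left_continuity_point u a b : a < b ->
  exists2 x, a < x < b & {for x, continuous (left_part u)}.
Proof. by apply: nondecreasing_continuity_point => x y; apply: (profile_l_le (profile_of_fuzzy (u := u))). Qed.

Lemma right_continuity_point u a b : a < b ->
  exists2 x, a < x < b & {for x, continuous (right_part u)}.
Proof. by apply: nonincreasing_continuity_point => x y; apply: (profile_r_le (profile_of_fuzzy (u := u))). Qed.

(** Right continuity of the left part leaves room for a continuity point r2 > t
    with height still below a; the right half of the step number is arbitrary. *)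
Lemma D0_left_witness u t a : - M < inf (core u) -> - M <= t < inf (core u) ->
  left_part u t < a -> exists2 w, D0 u w & left_part w t < a.
Proof.
move=> Mc /andP[Mt tc] ua; have [t' tt' ua'] := profile_l_usc (profile_of_fuzzy (u := u)) ua.
have tm : t < Num.min t' (inf (core u)) by rewrite lt_min tt'.
have [r2 /andP[tr2]] := left_continuity_point u tm.
rewrite lt_min => /andP[r2t' r2c] cr2.
have [r1 /andP[r21 r1c] cr1] := right_continuity_point u r2c.
have cM := core_inf_le u.
have ur2 : left_part u r2 < a.
  by apply: le_lt_trans ua'; apply: (profile_l_le (profile_of_fuzzy (u := u))); apply: ltW.
have ur2' : left_part u r2 < 1 by rewrite left_part_lt1.
have um : left_part u r2 < Num.min a 1 by rewrite lt_min ur2.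
pose p2 := (left_part u r2 + Num.min a 1) / 2.
have p2a : p2 < a by apply: (@lt_le_trans _ _ (Num.min a 1)); [rewrite /p2; lra|rewrite ge_min lexx].
have p21 : p2 < 1 by apply: (@lt_le_trans _ _ (Num.min a 1)); [rewrite /p2; lra|rewrite ge_min lexx orbT].
have p2u : left_part u r2 < p2 by rewrite /p2; lra.
have hp2 : I01 p2 by apply: I01_mk; have := I01_ge0 (left_part01 u r2); lra.
have hp1 : I01 (1 / 2 : R) by apply: I01_mk; lra.
have [w [wl wr]] := @step_fuzzy (1 / 2) p2 r1 r2 hp1 hp2 ltac:(lra) ltac:(lra) ltac:(lra).
exists w.
  left; split=> //; exists (1 / 2), p2, r1, r2; split=> //.
  - by split; lra.
  - by rewrite p2u p21 right_part_lt_core //; split; lra.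
by rewrite wl /step_left (ltNge t (- M)) Mt /= tr2.
Qed.

Lemma D0_right_witness u r1 p1 : - M < r1 -> r1 <= M ->
  {for r1, continuous (right_part u)} -> 0 < p1 < right_part u r1 ->
  exists2 w, D0 u w & right_part w r1 = p1.
Proof.
move=> Mr1 r1M cr1 p1r; have /andP[p10 p1u] := p1r.
have hp1 : I01 p1 by apply: I01_mk; have := I01_le1 (right_part01 u r1); lra.
have := core_inf_ge (u := u); rewrite le_eqVlt => /orP[/eqP Mc|Mc].
  have [w [wl wr]] := @step_fuzzy p1 1 r1 (- M) hp1 (@I01_1 R) (lexx _) (ltW Mr1) r1M.
  exists w; last by rewrite wr /step_right leNgt Mr1 /= lexx.
  by right; split=> //; exists p1, r1; split=> //; rewrite r1M ltW.
have Mm : - M < Num.min r1 (inf (core u)) by rewrite lt_min Mr1.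
have [r2 /andP[Mr2]] := left_continuity_point u Mm.
rewrite lt_min => /andP[r21 r2c] cr2.
have ur2 : left_part u r2 < 1 by rewrite left_part_lt1.
pose p2 := (left_part u r2 + 1) / 2.
have p2u : left_part u r2 < p2 by rewrite /p2; lra.
have p21 : p2 < 1 by rewrite /p2; lra.
have hp2 : I01 p2 by apply: I01_mk; have := I01_ge0 (left_part01 u r2); lra.
have [w [wl wr]] := step_fuzzy hp1 hp2 (ltW Mr2) (ltW r21) r1M.
exists w; last by rewrite wr /step_right leNgt r21 /= lexx.
left; split=> //; exists p1, p2, r1, r2; split=> //; last by rewrite p2u p21.
by split; lra.
Qed.

(** Both inequalities are checked up to a margin a.  The semicontinuity of the
    parts of u and c leaves an interval in which the jump of a step number can
    be placed at a continuity point. *)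
Lemma D0_dense u c b : I01 b -> (forall w, D0 u w -> b <= PM T w c) -> b <= PM T u c.
Proof.
move=> hb h; have {}h w : D0 u w -> forall x,
    T b (left_part c x) <= left_part w x /\ T b (right_part w x) <= right_part c x.
  by move=> /h; exact: (PMP hT w c hb).1.
apply/(PMP hT) => // t; split.
  case: (ltP t (- M)) => [tM|Mt].
    by rewrite (profile_l0 (profile_of_fuzzy (u := c))) // (Tx0 hT) //; apply: I01_ge0.
  case: (ltP (left_part u t) 1) => [|ge1]; last first.
    by apply: le_trans ge1; apply: I01_le1; apply: T01.
  rewrite left_part_lt1 => tc; apply: ge_by_gt => a ua.
  have [|w Dw wa] := D0_left_witness (le_lt_trans Mt tc) _ ua; first by rewrite Mt.
  exact: le_trans ((h w Dw t).1) (ltW wa).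
case: (leP t (- M)) => [tM|Mt].
  by rewrite (profile_r1 (profile_of_fuzzy (u := c)) tM); apply: I01_le1; apply: T01.
case: (leP t M) => [tM|Mt']; last first.
  by rewrite (profile_r0 (profile_of_fuzzy (u := u))) // (Tx0 hT) //; apply: I01_ge0.
apply: ge_by_gt => a /(profile_r_usc (profile_of_fuzzy (u := c)))[t' tt' ca].
have mt : Num.max t' (- M) < t by rewrite gt_max tt'.
have [r1 /andP[]] := right_continuity_point u mt.
rewrite gt_max => /andP[t'r1 Mr1] r1t cr1.
apply: (@le_trans _ _ (T b (right_part u r1))).
  by apply: (T_le hT) => //; apply: (profile_r_le (profile_of_fuzzy (u := u))); apply: ltW.
apply: le_trans (ltW ca); apply: (T_le_lim hT) => //; first exact: I01_ge0.
move=> p1 hp1 p1u; have := I01_ge0 hp1; rewrite le_eqVlt => /orP[/eqP<-|p10].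
  by rewrite (Tx0 hT) //; apply: I01_ge0.
have r1M : r1 <= M by lra.
have p1r : 0 < p1 < right_part u r1 by rewrite p10.
have [w Dw <-] := D0_right_witness Mr1 r1M cr1 p1r.
apply: le_trans ((h w Dw r1).2) _; apply: (profile_r_le (profile_of_fuzzy (u := c))); exact: ltW.
Qed.

Let sqleE u v : sqle T u v <-> 1 <= PM T u v.
Proof.
split=> [->//|h]; apply/eqP; rewrite eq_le h andbT; exact: I01_le1.
Qed.

(** The induction starts at the empty family, whose join is the bottom element. *)
Lemma family_join k (f : 'I_k -> fuzzy_on M) : exists w, forall z b, I01 b ->
  b <= PM T w z <-> forall i, b <= PM T (f i) z.
Proof.
elim: k f => [|k IHk] f.
  have [w hw] := fuzzy_bottom (T := T) hT M_gt0; exists w => z b hb.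
  by rewrite hw; split=> [_ []//|_]; apply: I01_le1.
have [w hw] := IHk (fun i => f (lift ord0 i)).
have [w' hw'] := fuzzy_join hT (f ord0) w.
exists w' => z b hb; rewrite hw' // hw //; split=> [[h0 h] i|h].
  by case: (unliftP ord0 i) => [j ->|->].
by split=> // i; apply: h.
Qed.

(** A join is only specified by the order, but an enriched join exists and
    order joins are unique up to isomorphism. *)
Lemma is_join_hom k (f : 'I_k -> fuzzy_on M) w z b : is_join T f w -> I01 b ->
  b <= PM T w z <-> forall i, b <= PM T (f i) z.
Proof.
move=> [w_ub w_least] hb; have [w' hw'] := family_join f.
have ww' : PM T w w' = 1.
  apply: w_least => i; apply/sqleE; move: i; apply/hw' => //; first exact: I01_1.
  by rewrite homxx.
have w'w : PM T w' w = 1.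
  by apply/sqleE/hw' => [|i]; [apply: I01_1|apply/sqleE].
rewrite -hw' //; split=> h; apply: le_trans h _; exact: (hom1_le_l hT enc).
Qed.

Lemma D0_sub_Djoin u w : D0 u w -> Djoin T u w.
Proof.
move=> Dw; exists 1%N, (fun=> w); split=> //; split=> [_|z h]; first exact/homxx.
exact: h ord0.
Qed.

(** Concatenating two families joins their joins. *)
Lemma Djoin_directed u w1 w2 : Djoin T u w1 -> Djoin T u w2 ->
  exists w, [/\ Djoin T u w, PM T w1 w = 1 & PM T w2 w = 1].
Proof.
move=> [n1 [f1 [n1_gt0 Df1 [ub1 least1]]]] [n2 [f2 [n2_gt0 Df2 [ub2 least2]]]].
have [w hw] := fuzzy_join hT w1 w2.
have [/(_ ltac:(by rewrite homxx)) [/sqleE w1w /sqleE w2w] _] := hw w 1 (@I01_1 R).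
exists w; split=> //.
have trans (x y z : fuzzy_on M) : sqle T x y -> sqle T y z -> sqle T x z.
  move=> xy yz; apply/sqleE; have <- : PM T x y = 1 by [].
  exact: (hom1_le_r hT enc).
exists (n1 + n2)%N, (fun i : 'I_(n1 + n2) => match fintype.split i with inl j => f1 j | inr j => f2 j end).
split; first by rewrite addn_gt0 n1_gt0.
  by move=> i; case: (fintype.split i).
split=> [i|z hz]; first by case: (fintype.split i) => j; [apply: trans (ub1 j) _|apply: trans (ub2 j) _].
apply/sqleE/hw; first exact: I01_1.
split; apply/sqleE.
  by apply: least1 => j; have := hz (lshift n2 j); rewrite (unsplitK (inl j)).
by apply: least2 => j; have := hz (rshift n1 j); rewrite (unsplitK (inr j)).
Qed.

Let bottom u := is_limit T (@PM R T M) (@sup_coweight R T M) u.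

(** The coweight is constantly 1, so its limit is a least element. *)
Lemma bottomP u : bottom u <-> forall z, PM T u z = 1.
Proof.
have sup1E v : sup_coweight T v = 1.
  have f01 : unit_valued (fun e : fuzzy_on M => PM T e v) by move=> e; apply: hom01.
  apply/eqP; rewrite eq_le (I01_le1 (sup_range01 f01 u)) /= -(homxx v).
  exact: (sup_range_ge f01 v).
have limE (x : fuzzy_on M) : inf (range (fun v => res T (sup_coweight T v) (PM T x v))) =
    inf (range (fun v => PM T x v)).
  by congr inf; apply: eq_imagel => y _; rewrite sup1E (res1x hT).
have f01 (x : fuzzy_on M) : unit_valued (fun v => PM T x v) by move=> y; apply: hom01.
split=> [lim_u z|h x]; last rewrite limE.
  apply/eqP; rewrite eq_le (I01_le1 (hom01 _ _)) /= -(homxx u) lim_u limE.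
  exact: (inf_range_le (f01 u) z).
apply/eqP; rewrite eq_le (inf_range_le (f01 x) u) andbT.
by apply/(inf_rangeP (f01 x) u) => y; apply: (hom1_le_r hT enc).
Qed.

(** If the core starts at -M and the right part vanishes beyond -M, then u is
    the bottom element. *)
Lemma D0_nonempty u : ~ bottom u -> D0 u !=set0.
Proof.
move=> nb; have := core_inf_ge (u := u); rewrite le_eqVlt => /orP[/eqP Mc|Mc]; last first.
  have [||w Dw _] := @D0_left_witness u (- M) 1 Mc; last by exists w.
    by rewrite lexx.
  by rewrite left_part_lt1.
have [t Mt ut] : exists2 t, - M < t & 0 < right_part u t.
  apply: contrapT => none; apply: nb; apply/bottomP => z; apply/(PM_eq1 hT) => x.
  split.
    case: (ltP x (- M)) => xM; first by rewrite (profile_l0 (profile_of_fuzzy (u := z))) ?I01_ge0.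
    have : ~~ (left_part u x < 1) by rewrite left_part_lt1 -Mc -leNgt.
    by rewrite -leNgt; apply: le_trans; apply: I01_le1.
  case: (leP x (- M)) => xM; first by rewrite (profile_r1 (profile_of_fuzzy (u := z))) // I01_le1.
  apply: le_trans (I01_ge0 (right_part01 z x)); rewrite leNgt; apply/negP => ux.
  by apply: none; exists x.
have tM : t <= M.
  by rewrite leNgt; apply/negP => /(profile_r0 (profile_of_fuzzy (u := u))) u0; rewrite u0 ltxx in ut.
have [r1 /andP[Mr1 r1t] cr1] := right_continuity_point u Mt.
have ur1 : right_part u t <= right_part u r1 by apply: (profile_r_le (profile_of_fuzzy (u := u))); apply: ltW.
have r1M : r1 <= M by lra.
have p1r : 0 < right_part u r1 / 2 < right_part u r1 by lra.
by have [w Dw _] := D0_right_witness Mr1 r1M cr1 p1r; exists w.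
Qed.

(** At the bottom element there are no step numbers with slack, but the element
    itself is way below itself. *)
Definition base u : set (fuzzy_on M) :=
  if pselect (bottom u) then [set u] else Djoin T u.

Lemma Phi_base u v : Phi T u v = sup [set PM T v w | w in base u].
Proof.
rewrite /Phi /base; case: (pselect (bottom u)) => h //=.
by rewrite image_set1 sup1.
Qed.

Lemma base_nonempty u : base u !=set0.
Proof.
rewrite /base; case: pselect => [h|nb] /=; first by exists u.
by have [w Dw] := D0_nonempty nb; exists w; apply: D0_sub_Djoin.
Qed.

Lemma base_directed u (x y : fuzzy_on M) : base u x -> base u y ->
  exists z, [/\ base u z, PM T x z = 1 & PM T y z = 1].
Proof.
rewrite /base; case: pselect => [h /= -> ->|h /=]; first by exists u; rewrite homxx.
exact: Djoin_directed.
Qed.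

(** Joins reduce to step numbers: finitely many tails have a common tail, on
    which the bounds for the members of the family combine. *)
Lemma base_way_below u (psi : fc_ideal T (@PM R T M)) c b :
  is_colimit T (@PM R T M) psi c -> I01 b ->
  b <= PM T u c <-> forall w, base u w -> b <= psi w.
Proof.
move=> lim_c hb; have [[psi01 _] [D [le [n [dir _ psiE]]]]] := fc_idealP psi.
rewrite /base; case: pselect => [u_bot|not_bot] /=.
  have {}u_bot := (bottomP u).1 u_bot.
  rewrite u_bot; split=> [b1 w ->|_]; last exact: I01_le1.
  have [i] := directed_inh dir; rewrite psiE.
  by apply: (net_weight_ge hom01 dir (i := i)) => j _; rewrite u_bot.
split=> [b_uc w [k [f [_ Df join_w]]]|h].
  apply: (le_by_lt01 hb (I01_ge0 (psi01 w))) => b' hb' bb'.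
  have /choice[g hg] : forall i, exists d, forall j, le d j -> b' <= PM T (f i) (n j).
    move=> i; apply: (net_weight_gt hom01 dir); rewrite -psiE.
    exact: lt_le_trans bb' (way_below_step lim_c hb b_uc (Df i)).
  have [d gd] := directed_finite_ub g dir.
  rewrite psiE; apply: (net_weight_ge hom01 dir (i := d)) => j dj.
  apply: (is_join_hom (n j) join_w hb').2 => i.
  exact: hg (directed_trans dir (gd i) dj).
apply: (D0_dense hb) => w Dw; apply: le_trans (colimit_ub hT enc w psi01 lim_c).
by apply: h; apply: D0_sub_Djoin.
Qed.

End WayBelow.

Theorem theorem5p20 (R : realType) (T : R -> R -> R) (M : R)
  (hT : continuous_tnorm T) (hS : S_condition T) (hM : 0 < M) :
  exists D : enriched_domain T (@PM R T M),
    forall u v : fuzzy_on M,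
      way_below (domain_complete D) v u = Phi T u v.
Proof.
have [D hD] := domain_of_directed_bases hT (PM_encat hT)
  (fuzzy_yoneda_complete hT) (base_nonempty hT)
  (@base_directed _ _ _ hT) (@base_way_below _ _ _ hT hS hM).
by exists D => u v; rewrite hD Phi_base.
Qed.
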